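(* Let $2<q<p<\infty$. Suppose that there exist $\theta\in(0,1]$, $L\ge 1$, and $f:S_{L_q}\to L_p$ such that $$\|x-y\|_{L_q}^{\theta}\le\|f(x)-f(y)\|_{L_p}\le L\|x-y\|_{L_q}^{\theta},\qquad x,y\in S_{L_q}.$$ Then $\theta\le\frac qp$.
   Context: $L_p=L_p([0,1],\lambda)$ with $\lambda$ Lebesgue measure (real scalars); $S_{L_q}=\{x\in L_q:\|x\|_{L_q}=1\}$. *)

(* Defs.v *)
From HB Require Import structures.
From mathcomp Require Import all_boot all_order all_algebra.
From mathcomp Require Import all_classical all_reals all_analysis.

Set Implicit Arguments.
Unset Strict Implicit.
Unset Printing Implicit Defensive.
Import Order.TTheory GRing.Theory Num.Theory.
Import numFieldNormedType.Exports.

Local Open Scope classical_set_scope.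
Local Open Scope ring_scope.

(* Functions on [0, 1] modulo a.e. equality are functions on the whole line
   modulo a.e. equality for this measure, which gives mass 0 to the complement
   of [0, 1]. *)
Definition lebesgue01 (R : realType) :
    {measure set (measurableTypeR R) -> \bar R} :=
  mrestr (@lebesgue_measure R) (measurable_itv `[0, 1]).

Lemma EFin_ge1 (R : realType) (p : R) : 2 < p -> (1 <= p%:E)%E.
Proof. by move=> p2; rewrite lee_fin; apply: ltW; apply: lt_trans p2; rewrite ltr1n. Qed.

Section Lp.
Context (R : realType) (p : R) (p1 : (1 <= p%:E)%E).

Definition Lp01 := LspaceType (lebesgue01 R) p1.

(* Elements of Lp01 are a.e. classes, applied through a chosen representative;
   the two quantities below do not depend on that choice. *)
Definition Lpnorm (x : Lp01) : \bar R :=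
  Lnorm (lebesgue01 R) p%:E (fun t => (x t : R)%:E).

Definition Lpdist (x y : Lp01) : \bar R :=
  Lnorm (lebesgue01 R) p%:E (fun t => ((x t : R) - (y t : R))%:E).

Definition Lpsphere : set Lp01 := [set x | Lpnorm x = 1%E].

End Lp.

Arguments Lpsphere {R p} p1.

(* Main.v *)
From HB Require Import structures.
Require Import Defs.
From mathcomp Require Import all_boot all_order all_algebra.
From mathcomp Require Import all_classical all_reals all_analysis.
From mathcomp Require Import measurable_realfun zify ring lra.
Import Order.TTheory GRing.Theory Num.Theory.
Local Open Scope classical_set_scope.
Local Open Scope ring_scope.

(** Suppose that theta > q / p and put s = theta * p / q, so that s > 1. The
contradiction comes from an inequality that every map into Lp satisfies on a
finite abelian group, tested on discrete tori inside the unit sphere of Lq.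

The inequality (metric_Xp_Lp) is of the type of the metric Xp inequalities of
Naor and Schechtman. Let v_0, ..., v_(n-1) be elements of a finite abelian
group, let S be a random set of indices of density d, let e, e' be independent
uniform signs, and write e_S for the sum of the e_i v_i over i in S. Averaging
over x, S, e, e',
  E |F(x + 2m e_S) - F(x)|^p <= C (E |F(x + e_(S^c)) - F(x)|^p
     + m^p (d * sum_i E |F(x + e) - F(x + e^i)|^p
            + d^(p/2) * E |F(x + e) - F(x + e')|^p)),
where e also stands for the full signed sum, e^i is e with its i-th sign flipped,
and C depends only on p. Both sides are positive combinations of p-th powers
of distances, so integration over [0, 1] reduces the Lp-valued case to real
functions H (metric_Xp).

For real H, replace H by its average T_S H over the signs outside S; the first
term on the right pays for this, and 2m e_S is then travelled in m steps of
length 2 e_S, which costs the factor m^p. What remains is to bound the p-th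
moment of E[f | (e_i), i in S] for a centred function f on the cube, averaged
over S (explored_moment). Reveal the coordinates one at a time, each with
probability d, and average it out otherwise. The result is a martingale with
increments 0 or +-g_j, the latter with probability d. Rosenthal's inequality bounds its
p-th moment by that of (d * sum g_j^2)^(1/2), up to the sum of the
d * E |g_j|^p. Each g_j is a conditional expectation of the increment D_j of the
martingale that reveals everything, given what has been explored; by convexity
(explore_le_full) the g_j can be replaced by the D_j, and the square function
inequality of Burkholder (square_function) bounds E (sum D_j^2)^(p/2) by
E |f|^p. The power d^(p/2) comes from d inside the square root. Both martingale
inequalities are proved by exhibiting a function of the current value and of the
accumulated quadratic variation that decreases on average along the process.

The torus (sphere_torus) is (Z/4m)^n; a point x is sent to the function taking
the values c * w(x_j + b), j < n, b in Z/4m, on intervals of equal length, where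
w is the triangle wave. Translation invariance puts all the points on the
sphere. Since w changes sign under a half-turn 2m, a half-turn in the
coordinates of S has length exactly 2 (|S|/n)^(1/q), whereas moving a proportion
t of the coordinates by at most two steps has length at most (8/m) t^(1/q).
With the bounds on the map, the inequality becomes, up to constants,
  (d m^q)^s <= 1 + m^p (d n^(1-s) + d^(p/2)).
As s > 1, the edge term disappears for n large; with d = B m^(-q) the left side
is B^s, and m^p d^(p/2) = (B m^(2-q))^(p/2) is at most 1 for m large because
q > 2. For B large this is absurd (scaling_contradiction). *)

(** * Powers and discrete cubes *)

(** The tangent line at y lies below the convex power t^s. This is Young's
inequality for the product of x and y^(s-1). *)
Lemma powR_tangent (R : realType) (s x y : R) : 1 <= s -> 0 <= x -> 0 <= y ->
  y `^ s + s * y `^ (s - 1) * (x - y) <= x `^ s.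
Proof.
move=> s1 x0 y0; have s0 : 0 < s by lra.
have [s1'|s1'] := eqVneq s 1.
  by rewrite s1' subrr powRr0 !powRr1//; lra.
have sm : 0 < s - 1 by rewrite subr_gt0 lt_neqAle eq_sym s1'.
have /= := @conjugate_powR R x (y `^ (s - 1)) s (s / (s - 1)) x0 (powR_ge0 _ _) s0.
rewrite -powRrM mulrCA divff ?gt_eqF// mulr1.
rewrite divr_gt0// => /(_ isT) H.
have /H : s^-1 + (s / (s - 1))^-1 = 1 by field; rewrite !gt_eqF.
have ys : y * y `^ (s - 1) = y `^ s by rewrite mulr_powRB1.
rewrite -(ler_pM2l s0).
have -> : s * (x `^ s / s + y `^ s / (s / (s - 1))) = x `^ s + (s - 1) * y `^ s.
  by field; rewrite !gt_eqF.
by rewrite -ys => {}H; nra.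
Qed.

(** The convex power t^(1/s), at x^s and y^s, solved for x^s. *)
Lemma powR_tangent_concave (R : realType) (s x y : R) :
  0 < s -> s <= 1 -> 0 <= x -> 0 < y ->
  x `^ s <= y `^ s + s * y `^ (s - 1) * (x - y).
Proof.
move=> s0 s1 x0 y0.
have si : 1 <= s^-1 by rewrite invf_ge1.
have := @powR_tangent R s^-1 (x `^ s) (y `^ s) si (powR_ge0 _ _) (powR_ge0 _ _).
rewrite -!powRrM divff ?gt_eqF// !powRr1 ?(ltW y0)//.
have -> : s * (s^-1 - 1) = - (s - 1) by field; rewrite gt_eqF.
rewrite powRN => H.
have ysg : 0 < y `^ (s - 1) by rewrite powR_gt0.
have : s * y `^ (s - 1) * (y + s^-1 / y `^ (s - 1) * (x `^ s - y `^ s)) <=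
  s * y `^ (s - 1) * x by rewrite ler_pM2l// mulr_gt0.
have -> : s * y `^ (s - 1) * (y + s^-1 / y `^ (s - 1) * (x `^ s - y `^ s)) =
  s * y `^ (s - 1) * y + (x `^ s - y `^ s) by field; rewrite !gt_eqF.
lra.
Qed.

(** Jensen's inequality for any average follows by averaging such a support
line at the mean; the value of the slope c is irrelevant. *)
Lemma norm_powR_tangent (R : realType) (p a : R) : 1 <= p ->
  exists c, forall y : R, `|a| `^ p + c * (y - a) <= `|y| `^ p.
Proof.
move=> p1; exists (p * `|a| `^ (p - 1) * Num.sg a) => y.
apply: le_trans (@powR_tangent R p `|y| `|a| p1 (normr_ge0 _) (normr_ge0 _)).
rewrite lerD2l -mulrA ler_wpM2l//.
  by rewrite mulr_ge0 ?powR_ge0//; lra.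
have [->|a0] := eqVneq a 0; first by rewrite sgr0 mul0r normr0 subr0.
rewrite mulrBr -normrEsg lerB//.
apply: le_trans (ler_norm _) _.
by rewrite normrM normr_sg a0 mul1r.
Qed.

Lemma norm_powR_mid (R : realType) (p a b : R) : 1 <= p ->
  `|(a + b) / 2| `^ p <= (`|a| `^ p + `|b| `^ p) / 2.
Proof.
move=> p1; have [c hc] := @norm_powR_tangent R p ((a + b) / 2) p1.
have := hc a; have := hc b; lra.
Qed.

(** Young's inequality with a prescribed small weight: for b <= e a the product
is absorbed by the first term, for a < b / e it is dominated by the second. *)
Lemma powR_absorb (R : realType) (K u v : R) : 0 < K -> 0 < u -> 0 < v ->
  exists2 C, 0 < C & forall a b : R, 0 <= a -> 0 <= b ->
    K * (a `^ u * b `^ v) <= a `^ (u + v) / 2 + C * b `^ (u + v).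
Proof.
move=> K0 u0 v0.
have uv0 : 0 < u + v by rewrite addr_gt0.
have D x : x `^ (u + v) = x `^ u * x `^ v by rewrite powRD// (gt_eqF uv0).
pose e := (2 * K) `^ (- v^-1).
have e0 : 0 < e by rewrite powR_gt0// mulr_gt0.
(* e is chosen so that the case b <= e a yields exactly the weight 1/2 *)
have eK : K * e `^ v = 2^-1.
  rewrite -powRrM mulNr mulVf ?gt_eqF// powRN powRr1; last by rewrite mulr_ge0// ltW.
  by field; rewrite gt_eqF.
exists (K * (e^-1) `^ u); first by rewrite mulr_gt0// powR_gt0// invr_gt0.
move=> a b a0 b0.
have [bea|bea] := leP b (e * a).
  have bv : b `^ v <= e `^ v * a `^ v.
    rewrite -powRM ?(ltW e0)//; apply: ge0_ler_powR => //; rewrite ?nnegrE ?(ltW v0)//.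
    by rewrite mulr_ge0// ltW.
  have : K * (a `^ u * b `^ v) <= a `^ (u + v) / 2.
    rewrite D.
    apply: (@le_trans _ _ (K * (a `^ u * (e `^ v * a `^ v)))).
      by rewrite ler_pM2l// ler_wpM2l// powR_ge0.
    rewrite (_ : K * _ = K * e `^ v * (a `^ u * a `^ v)); last by ring.
    by rewrite eK; lra.
  move=> h; apply: (le_trans h); rewrite lerDl.
  by apply: mulr_ge0 (powR_ge0 _ _); apply: mulr_ge0 (powR_ge0 _ _); exact: ltW.
apply: (@le_trans _ _ (K * (e^-1) `^ u * b `^ (u + v))); last first.
  by rewrite lerDr divr_ge0// powR_ge0.
have au : a `^ u <= e^-1 `^ u * b `^ u.
  rewrite -powRM ?invr_ge0 ?(ltW e0)//.
  have aeb : a <= e^-1 * b by rewrite ler_pdivlMl// ltW.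
  by apply: ge0_ler_powR; rewrite ?nnegrE ?(ltW u0)// (le_trans a0).
rewrite D.
rewrite [leRHS](_ : _ = K * (e^-1 `^ u * b `^ u * b `^ v)); last by ring.
by rewrite ler_pM2l// ler_wpM2r// powR_ge0.
Qed.

Lemma norm_powR_sum (R : realType) (p : R) m (a : 'I_m -> R) : 1 <= p ->
  m%:R * `|\sum_i a i| `^ p <= m%:R `^ p * \sum_i `|a i| `^ p.
Proof.
move=> p1; have [m0|m0] := eqVneq m 0%N.
  by rewrite {1}m0 mul0r mulr_ge0 ?powR_ge0// sumr_ge0// => i _; exact: powR_ge0.
have m0' : 0 < m%:R :> R by rewrite ltr0n lt0n.
set s := \sum_i a i; pose u := s / m%:R.
have sE : s = m%:R * u by rewrite mulrC divfK// gt_eqF.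
have [c hc] := @norm_powR_tangent R p u p1.
have : \sum_(i < m) (`|u| `^ p + c * (a i - u)) <= \sum_i `|a i| `^ p.
  by apply: ler_sum => i _; exact: hc.
rewrite big_split/= -mulr_sumr sumrB !sumr_const card_ord -/s -(mulr_natl (`|u| `^ p)) -(mulr_natl u).
rewrite -sE subrr mulr0 addr0 => h.
apply: le_trans (ler_wpM2l (powR_ge0 _ _) h).
by rewrite sE normrM normr_nat powRM// mulrCA.
Qed.

Lemma norm_powR_add (R : realType) (p a b : R) : 1 <= p ->
  `|a + b| `^ p <= 2 `^ p * (`|a| `^ p + `|b| `^ p).
Proof.
move=> p1; have := @norm_powR_sum R p 2 (fun i => if i == ord0 then a else b) p1.
rewrite !big_ord_recl !big_ord0 /= !addr0; apply: le_trans.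
by rewrite ler_peMl ?powR_ge0// ler1n.
Qed.

Section Cube.
Context {R : realType}.
Implicit Types (d p y : R) (f : seq bool -> R).

(** Expectation over n independent bits that are true with probability d. The
bits form a list, so that conditioning on the first of them is a structural
recursion; signs are coded by bits with d = 1/2. *)
Fixpoint bexp (d : R) n (f : seq bool -> R) : R :=
  if n is n'.+1 then
    d * bexp d n' (fun l => f (true :: l)) + (1 - d) * bexp d n' (fun l => f (false :: l))
  else f [::].

Local Notation mean := (bexp 2^-1).

Lemma meanS n f : mean n.+1 f =
  (mean n (fun l => f (true :: l)) + mean n (fun l => f (false :: l))) / 2.
Proof. by rewrite /=; lra. Qed.

Lemma eq_bexp d n f g : (forall l, size l = n -> f l = g l) -> bexp d n f = bexp d n g.
Proof.
elim: n f g => [|n IH] f g fg /=; first exact: fg.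
by congr (_ * _ + _ * _); apply: IH => l sl; apply: fg => /=; rewrite sl.
Qed.

Lemma bexp_lin d n a b f g : bexp d n (fun l => a * f l + b * g l) =
  a * bexp d n f + b * bexp d n g.
Proof. by elim: n f g => [//|n IH] f g /=; rewrite !IH; ring. Qed.

Lemma bexpS d n (f : seq bool -> R) : bexp d n.+1 f =
  d * bexp d n (fun l => f (true :: l)) + (1 - d) * bexp d n (fun l => f (false :: l)).
Proof. by []. Qed.

Lemma bexp_mid d n (f h : seq bool -> R) :
  bexp d n (fun l => (f l + h l) / 2) = (bexp d n f + bexp d n h) / 2.
Proof.
rewrite (@eq_bexp _ _ _ (fun l => 2^-1 * f l + 2^-1 * h l)) ?bexp_lin; first lra.
by move=> l _; lra.
Qed.

Lemma bexp_cst d n c : bexp d n (fun=> c) = c.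
Proof. by elim: n => [//|n IH] /=; rewrite !IH; ring. Qed.

Lemma le_bexp d n f g : 0 <= d -> d <= 1 -> (forall l, size l = n -> f l <= g l) ->
  bexp d n f <= bexp d n g.
Proof.
move=> d0 d1; elim: n f g => [|n IH] f g fg /=; first exact: fg.
by apply: lerD; apply: ler_wpM2l; rewrite ?subr_ge0//;
  apply: IH => l sl; apply: fg => /=; rewrite sl.
Qed.

Lemma bexp_jensen d n p f : 0 <= d -> d <= 1 -> 1 <= p ->
  `|bexp d n f| `^ p <= bexp d n (fun l => `|f l| `^ p).
Proof.
move=> d0 d1 p1; have [c hc] := @norm_powR_tangent R p (bexp d n f) p1.
have : bexp d n (fun l => 1 * (`|bexp d n f| `^ p - c * bexp d n f) + c * f l) <=
   bexp d n (fun l => `|f l| `^ p).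
  by apply: le_bexp => // l _; apply: le_trans (hc (f l)); rewrite mulrBr; lra.
by rewrite bexp_lin bexp_cst; lra.
Qed.

(** The sum over the n directions of the mean of k over the edges of the cube in
that direction. For k = osc p f it is the sum of the p-th moments of the
differences of f along the edges. *)
Fixpoint egrad n (k : seq bool -> seq bool -> R) : R :=
  if n is n'.+1 then
    mean n' (fun l => k (true :: l) (false :: l)) +
    (egrad n' (fun l l' => k (true :: l) (true :: l')) +
     egrad n' (fun l l' => k (false :: l) (false :: l'))) / 2
  else 0.

Lemma half01 : (0 <= 2^-1 :> R) /\ (2^-1 <= 1 :> R).
Proof. by split; lra. Qed.

Lemma le_egrad n k1 k2 : (forall l l', k1 l l' <= k2 l l') -> egrad n k1 <= egrad n k2.
Proof.
have [h0 h1] := half01.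
elim: n k1 k2 => [//|n IH] k1 k2 k12 /=; apply: lerD; first exact: le_bexp.
by rewrite ler_pM2r ?invr_gt0//; apply: lerD; exact: IH.
Qed.

Lemma egrad_lin n a b k1 k2 : egrad n (fun l l' => a * k1 l l' + b * k2 l l') =
  a * egrad n k1 + b * egrad n k2.
Proof. by elim: n k1 k2 => [|n IH] k1 k2 /=; rewrite ?bexp_lin ?IH; lra. Qed.

(** Updates the square root y of the accumulated quadratic variation by an
increment g. The square root is the better state variable because y^p is convex
in it and quad is a norm, see explore1_mid. *)
Definition quad y (g : R) := Num.sqrt (y ^+ 2 + g ^+ 2).

Lemma quad_ge0 y g : 0 <= quad y g. Proof. exact: sqrtr_ge0. Qed.

Lemma sqr_quad y g : quad y g ^+ 2 = y ^+ 2 + g ^+ 2.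
Proof. by rewrite sqr_sqrtr// addr_ge0// sqr_ge0. Qed.

Lemma le_quad y g : 0 <= y -> y <= quad y g.
Proof. by move=> y0; rewrite -(ler_pXn2r (n:=2)) ?nnegrE ?quad_ge0// sqr_quad lerDl sqr_ge0. Qed.

Lemma quad_mid y y0 y1 g0 g1 : 0 <= y -> 0 <= y0 -> 0 <= y1 -> y <= (y0 + y1) / 2 ->
  quad y ((g0 + g1) / 2) <= (quad y0 g0 + quad y1 g1) / 2.
Proof.
move=> h h0 h1 hy; have q0 := quad_ge0 y0 g0; have q1 := quad_ge0 y1 g1.
rewrite -(ler_pXn2r (n:=2)) ?nnegrE ?quad_ge0//; last by lra.
rewrite sqr_quad.
have s0 := sqr_quad y0 g0; have s1 := sqr_quad y1 g1.
(* Cauchy-Schwarz in the plane *)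
have : y0 * y1 + g0 * g1 <= quad y0 g0 * quad y1 g1.
  apply: le_trans (ler_norm _) _.
  rewrite -(ler_pXn2r (n:=2)) ?nnegrE// ?mulr_ge0//.
  rewrite exprMn s0 s1 real_normK ?num_real//.
  have : 0 <= (y0 * g1 - y1 * g0) ^+ 2 by exact: sqr_ge0.
  by lra.
have : y ^+ 2 <= ((y0 + y1) / 2) ^+ 2 by rewrite ler_pXn2r// nnegrE; lra.
by rewrite !expr2 in s0 s1 *; lra.
Qed.

(** The expected terminal payoff h of the process that reads the coordinates of
f in order: each one is revealed with probability d and averaged out otherwise.
In either case the quadratic variation grows by the square of the increment that
revealing would cause, so that y is known before the coin is tossed. *)
Fixpoint explore (d : R) (h : R -> R -> R) n f (y : R) : R :=
  if n is n'.+1 then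
    let f1 := fun l => f (true :: l) in
    let f0 := fun l => f (false :: l) in
    let y' := quad y ((mean n' f1 - mean n' f0) / 2) in
    d * ((explore d h n' f1 y' + explore d h n' f0 y') / 2) +
    (1 - d) * explore d h n' (fun l => (f1 l + f0 l) / 2) y'
  else h (f [::]) y.

Lemma le_explore d h1 h2 n f y : 0 <= d -> d <= 1 -> 0 <= y ->
  (forall a z, 0 <= z -> h1 a z <= h2 a z) -> explore d h1 n f y <= explore d h2 n f y.
Proof.
move=> d0 d1 + h12; elim: n f y => [|n IH] f y y0 /=; first exact: h12.
by apply: lerD; apply: ler_wpM2l; rewrite ?subr_ge0// ?ler_pM2r ?invr_gt0//;
  rewrite ?lerD// IH// quad_ge0.
Qed.

Lemma explore_lin d a b h1 h2 n f y :
  explore d (fun m z => a * h1 m z + b * h2 m z) n f y =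
  a * explore d h1 n f y + b * explore d h2 n f y.
Proof. by elim: n f y => [//|n IH] f y /=; rewrite !IH; ring. Qed.

Definition quad_pow p (_ z : R) := z `^ p.

(** For the fully revealed process all increments are linear in f, so the p-th
power of their Euclidean norm is convex in the pair (f, y). *)
Lemma explore1_mid p n f0 f1 y y0 y1 : 1 <= p ->
  0 <= y -> 0 <= y0 -> 0 <= y1 -> y <= (y0 + y1) / 2 ->
  explore 1 (quad_pow p) n (fun l => (f0 l + f1 l) / 2) y <=
  (explore 1 (quad_pow p) n f0 y0 + explore 1 (quad_pow p) n f1 y1) / 2.
Proof.
move=> p1; elim: n f0 f1 y y0 y1 => [|n IH] f0 f1 y y0 y1 hy h0 h1 hle /=.
  rewrite /quad_pow; have := @norm_powR_mid R p y0 y1 p1.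
  rewrite !ger0_norm//; last by lra.
  apply: le_trans; apply: ge0_ler_powR; rewrite ?nnegrE//; lra.
rewrite !bexp_mid subrr !mul0r !addr0 !mul1r.
set D0 := (mean n (fun l => f0 (true :: l)) - _) / 2.
set D1 := (mean n (fun l => f1 (true :: l)) - _) / 2.
set D := (X in quad y X).
have -> : D = (D0 + D1) / 2 by rewrite /D /D0 /D1; lra.
have hq := @quad_mid y y0 y1 D0 D1 hy h0 h1 hle.
have i1 := @IH (fun l => f0 (true :: l)) (fun l => f1 (true :: l)) _ _ _
  (quad_ge0 _ _) (quad_ge0 _ _) (quad_ge0 _ _) hq.
have i2 := @IH (fun l => f0 (false :: l)) (fun l => f1 (false :: l)) _ _ _
  (quad_ge0 _ _) (quad_ge0 _ _) (quad_ge0 _ _) hq.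
lra.
Qed.

(** An averaged-out coordinate replaces f by the mean of its two restrictions,
which by convexity does not exceed the mean of the two outcomes of revealing
it. *)
Lemma explore_le_full d p n f y : 0 <= d -> d <= 1 -> 1 <= p -> 0 <= y ->
  explore d (quad_pow p) n f y <= explore 1 (quad_pow p) n f y.
Proof.
move=> d0 d1 p1; elim: n f y => [//|n IH] f y y0 /=.
set y' := quad _ _; have y'0 : 0 <= y' by exact: quad_ge0.
have i1 := IH (fun l => f (true :: l)) y' y'0.
have i2 := IH (fun l => f (false :: l)) y' y'0.
have i3 := IH (fun l => (f (true :: l) + f (false :: l)) / 2) y' y'0.
have := @explore1_mid p n (fun l => f (true :: l)) (fun l => f (false :: l)) y' y' y' p1 y'0 y'0 y'0.
move=> i4; have {}i4 := i4 ltac:(lra).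
rewrite subrr mul0r addr0 mul1r.
have := ler_wpM2l d0 (lerD i1 i2).
have d1' : 0 <= 1 - d by rewrite subr_ge0.
have := ler_wpM2l d1' (le_trans i3 i4).
lra.
Qed.

Definition osc p f := fun l l' : seq bool => `|f l - f l'| `^ p.

(** Averaging out a coordinate does not increase the gradient in the others. *)
Lemma egrad_mid p n f g : 1 <= p ->
  egrad n (osc p (fun l => (f l + g l) / 2)) <= (egrad n (osc p f) + egrad n (osc p g)) / 2.
Proof.
move=> p1; apply: (@le_trans _ _ (egrad n (fun l l' => 2^-1 * osc p f l l' + 2^-1 * osc p g l l'))).
  apply: le_egrad => l l'; rewrite /osc.
  have := @norm_powR_mid R p (f l - f l') (g l - g l') p1.
  rewrite (_ : (f l + g l) / 2 - (f l' + g l') / 2 = (f l - f l' + (g l - g l')) / 2); last by lra.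
  lra.
by rewrite egrad_lin; lra.
Qed.

(** If one step of the process decreases h on average up to c |g|^p, then the
expected payoff is at most the initial value of h plus the accumulated errors.
Those are bounded by the gradient because g is a mean of discrete
derivatives. *)
Lemma explore_super d p c h n f y : 0 <= d -> d <= 1 -> 1 <= p -> 0 <= c -> 0 <= y ->
  (forall m g z z', 0 <= z -> z <= z' -> z' ^+ 2 = z ^+ 2 + g ^+ 2 ->
    (1 - d) * h m z' + d * ((h (m + g) z' + h (m - g) z') / 2) <= h m z + c * `|g| `^ p) ->
  explore d h n f y <= h (mean n f) y + c * egrad n (osc p f).
Proof.
move=> d0 d1 p1 c0 + hh; have [h0 h1] := half01.
have d1' : 0 <= 1 - d by rewrite subr_ge0.
elim: n f y => [|n IH] f y y0; first by rewrite /= mulr0 addr0.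
rewrite [explore _ _ _ _ _]/= [egrad _ _]/= meanS.
set f1 := fun l => f (true :: l); set f0 := fun l => f (false :: l).
set g := (mean n f1 - mean n f0) / 2; set m := (mean n f1 + mean n f0) / 2.
set z := quad y g; have z0 : 0 <= z by exact: quad_ge0.
have i1 := IH f1 z z0; have i0 := IH f0 z z0.
have ii := IH (fun l => (f1 l + f0 l) / 2) z z0.
rewrite bexp_mid -/m in ii.
have := hh m g y z y0 (le_quad _ _ y0) (sqr_quad _ _).
rewrite (_ : m + g = mean n f1); last by rewrite /m /g; lra.
rewrite (_ : m - g = mean n f0); last by rewrite /m /g; lra.
move=> step.
have em := @egrad_mid p n f1 f0 p1.
have gg : `|g| `^ p <= mean n (fun l => osc p f (true :: l) (false :: l)).
  have -> : g = mean n (fun l => 2^-1 * f1 l + (- 2^-1) * f0 l) by rewrite bexp_lin /g; lra.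
  apply: le_trans (@bexp_jensen _ _ _ _ h0 h1 p1) _; apply: le_bexp => // l _.
  rewrite /osc; apply: ge0_ler_powR; rewrite ?nnegrE//; first by lra.
  rewrite (_ : _ + _ = (f1 l - f0 l) / 2); last by lra.
  rewrite normrM [`|2^-1|]ger0_norm//; have := normr_ge0 (f1 l - f0 l); rewrite /f1 /f0; lra.
rewrite -/(osc p f1) -/(osc p f0).
have k1 := ler_wpM2l c0 gg.
have k2 := ler_wpM2l d0 (lerD i1 i0).
have k3 := ler_wpM2l d1' (le_trans ii (lerD (lexx _) (ler_wpM2l c0 em))).
set E1 := egrad n (osc p f1) in em k2 k3 *; set E0 := egrad n (osc p f0) in em k2 k3 *.
rewrite -[X in X <= _]addr0; nra.
Qed.

End Cube.

(** * Moments of a partially revealed function *)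

Lemma sqr_powR (R : realType) (z s : R) : 0 <= z -> (z ^+ 2) `^ s = z `^ (2 * s).
Proof. by move=> z0; rewrite -powR_mulrn// -powRrM. Qed.

(** Second order Taylor estimate for t^p. For |g| <= |m| apply the tangent line
inequality to t^p at m + g and m - g, and to t^(p-1) to compare the two slopes;
for |g| > |m| the last term alone suffices. *)
Lemma norm_powR_taylor (R : realType) (p : R) : 2 < p ->
  exists2 c, 0 < c & forall m g : R, (`|m + g| `^ p + `|m - g| `^ p) / 2 <=
    `|m| `^ p + c * (`|m| `^ (p - 2) * g ^+ 2 + `|g| `^ p).
Proof.
move=> p2; have p0 : 0 < p by lra.
pose c1 := p * (p - 1) * 2 `^ (p - 2).
have c1p : 0 < c1 by rewrite !mulr_gt0 ?powR_gt0//; lra.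
have c2p : 0 < (2:R) `^ p by rewrite powR_gt0.
exists (c1 + 2 `^ p); first by rewrite addr_gt0.
have pos a b : 0 <= a -> 0 <= b -> (`|a + b| `^ p + `|a - b| `^ p) / 2 <=
    a `^ p + (c1 + 2 `^ p) * (a `^ (p - 2) * b ^+ 2 + b `^ p).
  move=> a0 b0.
  have A0 : 0 <= a `^ (p - 2) * b ^+ 2 by rewrite mulr_ge0 ?powR_ge0 ?sqr_ge0.
  have B0 : 0 <= b `^ p by exact: powR_ge0.
  have C0 : 0 <= a `^ p by exact: powR_ge0.
  rewrite ger0_norm ?addr_ge0//.
  have [ba|ab] := leP b a.
    rewrite ger0_norm ?subr_ge0//.
    have ab0 : 0 <= a + b by rewrite addr_ge0.
    have amb0 : 0 <= a - b by rewrite subr_ge0.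
    have t1 := @powR_tangent R p a (a + b) ltac:(lra) a0 ab0.
    have t2 := @powR_tangent R p a (a - b) ltac:(lra) a0 amb0.
    (* t1 and t2 leave the difference of the two slopes, which t3 bounds *)
    have t3 := @powR_tangent R (p - 1) (a - b) (a + b) ltac:(lra) amb0 ab0.
    rewrite (_ : p - 1 - 1 = p - 2) in t3; last by ring.
    have t4 : (a + b) `^ (p - 2) <= 2 `^ (p - 2) * a `^ (p - 2).
      by rewrite -powRM//; apply: ge0_ler_powR; rewrite ?nnegrE//; lra.
    have k1 : p * b * ((a + b) `^ (p - 1) - (a - b) `^ (p - 1)) <=
      p * b * ((p - 1) * (2 * b) * (a + b) `^ (p - 2)).
      by apply: ler_wpM2l; [rewrite mulr_ge0// ltW|lra].
    have k2 : p * (p - 1) * b ^+ 2 * (a + b) `^ (p - 2) <=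
       p * (p - 1) * b ^+ 2 * (2 `^ (p - 2) * a `^ (p - 2)).
      by apply: ler_wpM2l => //; rewrite !mulr_ge0 ?sqr_ge0//; lra.
    have k3 : 0 <= 2 `^ p * (a `^ (p - 2) * b ^+ 2 + b `^ p).
      by rewrite mulr_ge0 ?addr_ge0// ltW.
    have k4 : 0 <= c1 * b `^ p by rewrite mulr_ge0// ltW.
    rewrite /c1 in k4 *; lra.
  have k1 : (a + b) `^ p <= 2 `^ p * b `^ p.
    by rewrite -powRM//; apply: ge0_ler_powR; rewrite ?nnegrE//; lra.
  have k2 : `|a - b| `^ p <= 2 `^ p * b `^ p.
    rewrite -powRM//; apply: ge0_ler_powR; rewrite ?nnegrE//; try lra.
    by rewrite ltr0_norm ?subr_lt0//; lra.
  have k3 : 0 <= 2 `^ p * (a `^ (p - 2) * b ^+ 2) by rewrite mulr_ge0// ltW.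
  have k4 : 0 <= c1 * (a `^ (p - 2) * b ^+ 2 + b `^ p) by rewrite mulr_ge0 ?addr_ge0// ltW.
  lra.
move=> m g; have := pos `|m| `|g| (normr_ge0 _) (normr_ge0 _).
rewrite real_normK ?num_real//; apply: le_trans.
rewrite le_eqVlt; apply/orP; left; apply/eqP.
have [m0|m0] := leP 0 m; have [g0|g0] := leP 0 g.
- by rewrite (ger0_norm m0) (ger0_norm g0).
- by rewrite (ger0_norm m0) (ltr0_norm g0) opprK addrC.
- rewrite (ltr0_norm m0) (ger0_norm g0) -(normrN (m + g)) -(normrN (m - g)) addrC.
  by rewrite !opprD opprK.
- by rewrite (ltr0_norm m0) (ltr0_norm g0) -(normrN (m + g)) -(normrN (m - g)) !opprD.
Qed.

Section OneStep.
Context {R : realType}.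

(** A function h of the current value m and of z, the square root of the sum of
the g_j^2, which dominates |m|^p / 2 up to the p-th power of d^(1/2) z and
decreases on average up to an error c d |g|^p. By explore_super this is
Rosenthal's inequality for the partially revealed martingale. *)
Definition rosenthal_supersolution (p : R) : Prop := exists C c, [/\ 0 < C, 0 < c &
  forall d, 0 <= d -> d <= 1 -> exists h : R -> R -> R,
    [/\ h 0 0 <= 0,
        forall m z, 0 <= z -> 2^-1 * `|m| `^ p <= h m z + C * (d `^ (p / 2) * z `^ p) &
        forall m g z z', 0 <= z -> z <= z' -> z' ^+ 2 = z ^+ 2 + g ^+ 2 ->
          (1 - d) * h m z' + d * ((h (m + g) z' + h (m - g) z') / 2)
            <= h m z + c * d * `|g| `^ p]].

(** For p >= 3 the function |m|^(p-2) is convex, so |m|^(p-2) z^2 grows on average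
by at least |m|^(p-2) g^2, which is the second order term of |m|^p. *)
Lemma supersolution_ge3 (p : R) : 3 <= p -> rosenthal_supersolution p.
Proof.
move=> p3; have [c c0 taylor] := @norm_powR_taylor R p ltac:(lra).
have [C C0 young] := @powR_absorb R c (p - 2) 2 c0 ltac:(lra) ltac:(lra).
exists C, c; split=> // d d0 d1.
exists (fun m z => `|m| `^ p - c * (`|m| `^ (p - 2) * (d * z ^+ 2))); split.
- by rewrite normr0 powR0; [rewrite expr0n mulr0 mulr0 mulr0 subr0|rewrite gt_eqF//; lra].
- move=> m z z0; have := young `|m| (d `^ 2^-1 * z) (normr_ge0 _).
  rewrite mulr_ge0 ?powR_ge0// => /(_ isT).
  rewrite subrK powR_mulrn ?mulr_ge0 ?powR_ge0// powRM ?powR_ge0//.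
  rewrite -[_ `^ _ `^ p]powRrM [2^-1 * p]mulrC exprMn.
  rewrite -[(d `^ _) ^+ 2]powR_mulrn ?powR_ge0// -powRrM mulVf ?pnatr_eq0// powRr1//.
  lra.
- move=> m g z z' z0 zz' e.
  have t := taylor m g.
  have cv := @norm_powR_mid R (p - 2) (m + g) (m - g) ltac:(lra).
  rewrite (_ : (m + g + (m - g)) / 2 = m) in cv; last by lra.
  have k1 := ler_wpM2l d0 t.
  have cd : 0 <= d * (c * (d * z' ^+ 2)) by exact: mulr_ge0 d0 (mulr_ge0 (ltW c0) (mulr_ge0 d0 (sqr_ge0 _))).
  have k2 := ler_wpM2l cd cv.
  rewrite e in k2 *; lra.
Qed.

(** For p < 3 the function |m|^(p-2) is no longer convex. With w = d^(1/2) z, the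
product m^2 w^(p-2) is used instead: with w' the new value of w, it grows by
d g^2 w'^(p-2) through m^2 and, as w^(p-2) is concave in w^2 for p <= 4, by at
least a multiple of m^2 w'^(p-4) d g^2 through w. The two gains together dominate
|m|^(p-2) d g^2. *)
Lemma supersolution_le4 (p : R) : 2 < p -> p <= 4 -> rosenthal_supersolution p.
Proof.
move=> p2 p4; have [c c0 taylor] := @norm_powR_taylor R p p2.
pose s := p - 2; have s0 : 0 < s by rewrite /s; lra.
pose K := c * (2 / s).
have K0 : 0 < K by rewrite /K !mulr_gt0// invr_gt0.
have [C C0 young] := @powR_absorb R K 2 s K0 ltac:(lra) s0.
exists C, c; split=> // d d0 d1.
exists (fun m z => `|m| `^ p - K * (m ^+ 2 * (d `^ 2^-1 * z) `^ s)); split.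
- by rewrite normr0 powR0; [rewrite expr0n mul0r mulr0 subr0|rewrite gt_eqF//; lra].
- move=> m z z0; have := young `|m| (d `^ 2^-1 * z) (normr_ge0 _).
  rewrite mulr_ge0 ?powR_ge0// => /(_ isT).
  rewrite (_ : 2 + s = p); last by rewrite /s; ring.
  rewrite powR_mulrn// real_normK ?num_real//.
  rewrite [(_ * z) `^ p]powRM ?powR_ge0//.
  rewrite -[_ `^ _ `^ p]powRrM [2^-1 * p]mulrC.
  lra.
- move=> m g z z' z0 zz' e; have z'0 := le_trans z0 zz'.
  set w := _ * z; set w' := _ * z'.
  have w0 : 0 <= w by rewrite mulr_ge0 ?powR_ge0.
  have w'0 : 0 <= w' by rewrite mulr_ge0 ?powR_ge0.
  have sd : (d `^ 2^-1) ^+ 2 = d.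
    by rewrite -powR_mulrn ?powR_ge0// -powRrM mulVf ?pnatr_eq0// powRr1.
  have we : w' ^+ 2 = w ^+ 2 + d * g ^+ 2 by rewrite !exprMn sd e mulrDr.
  have dg0 : 0 <= d * g ^+ 2 by rewrite mulr_ge0 ?sqr_ge0.
  have k1 := ler_wpM2l d0 (taylor m g); rewrite -/s in k1.
  suff key : c * (d * g ^+ 2 * `|m| `^ s) <=
      K * ((m ^+ 2 + d * g ^+ 2) * w' `^ s - m ^+ 2 * w `^ s) by lra.
  have [w'E|w'N] := eqVneq w' 0.
    have wE : w = 0.
      by apply/eqP; rewrite -sqrf_eq0; apply/eqP; move: we; rewrite w'E expr0n/=; have := sqr_ge0 w; lra.
    have -> : d * g ^+ 2 = 0 by move: we; rewrite w'E wE expr0n/=; lra.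
    rewrite w'E wE powR0 ?gt_eqF//; lra.
  have w'p : 0 < w' by rewrite lt_neqAle eq_sym w'N.
  have A : w `^ s <= w' `^ s - (s / 2) * w' `^ (s - 2) * (d * g ^+ 2).
    have := @powR_tangent_concave R (s / 2) (w ^+ 2) (w' ^+ 2) ltac:(rewrite divr_gt0//)
      ltac:(rewrite /s; lra) (sqr_ge0 _) ltac:(rewrite exprn_gt0//).
    rewrite !sqr_powR// (_ : 2 * (s / 2) = s); last by field.
    by rewrite (_ : 2 * (s / 2 - 1) = s - 2); [rewrite we; lra|field].
  (* the first term suffices if |m| <= w', the second one otherwise as s <= 2 *)
  have B : `|m| `^ s <= w' `^ s + m ^+ 2 * w' `^ (s - 2).
    have [mw|mw] := leP `|m| w'.
      apply: (@le_trans _ _ (w' `^ s)).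
        by apply: ge0_ler_powR => //; rewrite ?nnegrE// ltW.
      by rewrite lerDl mulr_ge0 ?sqr_ge0 ?powR_ge0.
    have m0 : 0 < `|m| := lt_trans w'p mw.
    apply: (@le_trans _ _ (m ^+ 2 * w' `^ (s - 2))); last by rewrite lerDr powR_ge0.
    rewrite -[m ^+ 2]real_normK ?num_real//.
    have -> : `|m| `^ s = `|m| ^+ 2 * `|m| `^ (s - 2).
      rewrite -powR_mulrn// -powRD ?(gt_eqF m0) ?implybT//.
      by congr (_ `^ _); ring.
    rewrite ler_wpM2l ?sqr_ge0//.
    rewrite (_ : s - 2 = - (2 - s)); last by ring.
    rewrite !powRN lef_pV2 ?posrE ?powR_gt0//.
    by apply: ge0_ler_powR; rewrite ?nnegrE ?(ltW mw)//; rewrite /s; lra.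
  have kB := ler_wpM2l dg0 B.
  have kB' := ler_wpM2l (ltW c0) kB.
  have kA : m ^+ 2 * w `^ s <= m ^+ 2 * (w' `^ s - s / 2 * w' `^ (s - 2) * (d * g ^+ 2)).
    by rewrite ler_wpM2l ?sqr_ge0.
  apply: le_trans kB' _.
  apply: (@le_trans _ _ (K * (d * g ^+ 2 * w' `^ s + m ^+ 2 * (s / 2 * w' `^ (s - 2) * (d * g ^+ 2))))).
    have e1 : K * (m ^+ 2 * (s / 2 * w' `^ (s - 2) * (d * g ^+ 2))) =
      c * (m ^+ 2 * (w' `^ (s - 2) * (d * g ^+ 2))) by rewrite /K; field; rewrite gt_eqF.
    have s2 : c * (d * g ^+ 2 * w' `^ s) <= K * (d * g ^+ 2 * w' `^ s).
      apply: ler_wpM2r; first by rewrite mulr_ge0 ?powR_ge0.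
      by rewrite /K ler_peMr ?(ltW c0)// ler_pdivlMr// mul1r /s; lra.
    lra.
  apply: ler_wpM2l; first exact: ltW.
  lra.
Qed.

Local Notation mean := (bexp 2^-1).

Lemma explore1_mean (k : R -> R) n f y :
  explore 1 (fun m _ => k m) n f y = mean n (fun l => k (f l)).
Proof.
elim: n f y => [//|n IH] f y; rewrite meanS /= !IH subrr mul0r addr0 mul1r.
by [].
Qed.

(** The square function inequality. The function z^p - (p/2) z^(p-2) m^2 decreases
on average: with z' the new value of z, the growth of z^p is at most
(p/2) z'^(p-2) g^2 by the tangent line inequality, and m^2 grows by g^2 on
average. Young's inequality then separates z from m. *)
Lemma square_function (p : R) : 2 < p -> exists2 C, 0 < C & forall n f,
  explore 1 (quad_pow p) n f 0 <= C * mean n (fun l => `|f l| `^ p).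
Proof.
move=> p2; have [C C0 young] := @powR_absorb R (p / 2) (p - 2) 2 ltac:(lra) ltac:(lra) ltac:(lra).
pose h m z := z `^ p - p / 2 * (z `^ (p - 2) * m ^+ 2).
exists (2 * C); first by lra.
move=> n f.
have S : explore 1 h n f 0 <= h (mean n f) 0 + 0 * egrad n (osc p f).
  apply: explore_super => //; first by lra.
  move=> m g z z' z0 zz' e; have z'0 := le_trans z0 zz'.
  rewrite subrr mul0r add0r mul1r mul0r addr0 /h.
  have := @powR_tangent R (p / 2) (z ^+ 2) (z' ^+ 2) ltac:(lra) (sqr_ge0 _) (sqr_ge0 _).
  rewrite !sqr_powR// (_ : 2 * (p / 2) = p); last by field.
  rewrite (_ : 2 * (p / 2 - 1) = p - 2); last by field.
  have : z `^ (p - 2) <= z' `^ (p - 2) by apply: ge0_ler_powR; rewrite ?nnegrE//; lra.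
  have pm : 0 <= p / 2 * m ^+ 2 by rewrite mulr_ge0 ?sqr_ge0//; lra.
  move=> /(ler_wpM2l pm) + ; rewrite e; lra.
have L : explore 1 (fun m z => 2^-1 * quad_pow p m z + 0 * 0) n f 0 <=
  explore 1 (fun m z => 1 * h m z + C * `|m| `^ p) n f 0.
  apply: le_explore => // m z z0; rewrite /quad_pow /h.
  have := young z `|m| z0 (normr_ge0 _).
  rewrite subrK powR_mulrn// real_normK ?num_real//; lra.
rewrite !explore_lin (explore1_mean (fun m => `|m| `^ p)) in L.
have h0 : h (mean n f) 0 = 0.
  by rewrite /h !powR0 ?gt_eqF//; [lra|rewrite subr_gt0|lra].
rewrite h0 in S; lra.
Qed.

(** Up to the gradient term, Rosenthal's inequality bounds the moment by the
exploration of z^p, which the full exploration dominates, and that is bounded by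
the square function inequality. *)
Lemma explored_moment (p : R) : 2 < p -> exists2 C, 0 < C & forall d n f,
  0 <= d -> d <= 1 -> mean n f = 0 ->
  explore d (fun m _ => `|m| `^ p) n f 0 <=
  C * (d * egrad n (osc p f) + d `^ (p / 2) * mean n (fun l => `|f l| `^ p)).
Proof.
move=> p2.
have [C [c [C0 c0 sup]]] : rosenthal_supersolution p.
  have [p3|p3] := leP 3 p; first exact: supersolution_ge3.
  by apply: supersolution_le4 => //; lra.
have [S S0 sq] := @square_function p p2.
exists (2 * c + 2 * C * S); first by rewrite addr_gt0 ?mulr_gt0.
move=> d n f d0 d1 f0.
have [h [h00 hlow hstep]] := sup d d0 d1.
have cd0 : 0 <= c * d by rewrite mulr_ge0// ltW.
have p1 : 1 <= p by lra.
have E := @explore_super R d p (c * d) h n f 0 d0 d1 p1 cd0 (lexx _) hstep.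
rewrite f0 in E.
have L : explore d (fun m z => 2^-1 * `|m| `^ p + 0 * 0) n f 0 <=
  explore d (fun m z => 1 * h m z + (C * d `^ (p / 2)) * quad_pow p m z) n f 0.
  by apply: le_explore => // m z z0; have := hlow m z z0; rewrite /quad_pow; lra.
rewrite !explore_lin in L.
have Q := le_trans (@explore_le_full R d p n f 0 d0 d1 p1 (lexx _)) (sq n f).
have Cd0 : 0 <= C * d `^ (p / 2) by rewrite mulr_ge0 ?powR_ge0// ltW.
have := ler_wpM2l Cd0 Q.
set G := egrad _ _ in E *; set M := bexp _ _ _; set P := d `^ _ in Cd0 L *.
have [h0 h1] := @half01 R.
have M0 : 0 <= M.
  rewrite -(@bexp_cst R 2^-1 n 0); apply: le_bexp => // l _; exact: powR_ge0.
have G0 : 0 <= G.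
  apply: le_trans (_ : egrad n (fun _ _ => 0 * 0 + 0 * 0) <= _).
    by rewrite egrad_lin; lra.
  by apply: le_egrad => l l'; rewrite !mul0r addr0; exact: powR_ge0.
have P0 : 0 <= P by exact: powR_ge0.
have k1 : 0 <= c * (P * M) by rewrite mulr_ge0 ?mulr_ge0// ltW.
have k2 : 0 <= C * S * (d * G) by rewrite !mulr_ge0// ltW.
lra.
Qed.

End OneStep.

(** * A metric inequality on finite abelian groups *)

Section Sampling.
Context {R : realType} {G : finZmodType}.
Implicit Types (g : nat -> G) (H : G -> R) (S l e : seq bool) (x : G).
Local Notation mean := (bexp 2^-1).

Definition signed g i (b : bool) : G := if b then g i else - g i.

(** The bit b selects S or its complement, so that the jumps along S and the
averages over the complement share one definition. *)
Definition walk n g (b : bool) S e : G :=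
  \sum_(i < n) (if nth false S i == b then signed g i (nth false e i) else 0).

Definition vertex n g e : G := \sum_(i < n) signed g i (nth false e i).

Lemma walk_cons n g b s S t e : walk n.+1 g b (s :: S) (t :: e) =
  (if s == b then signed g 0 t else 0) + walk n (fun i => g i.+1) b S e.
Proof. by rewrite /walk big_ord_recl. Qed.

Lemma vertex_cons n g t e : vertex n.+1 g (t :: e) =
  signed g 0 t + vertex n (fun i => g i.+1) e.
Proof. by rewrite /vertex big_ord_recl. Qed.

(** The average of H over the signs outside S, the T_S H of the introduction. *)
Definition smooth n g S H x := mean n (fun e => H (x + walk n g false S e)).

Lemma smooth_true n g S H x : smooth n.+1 g (true :: S) H x =
  smooth n (fun i => g i.+1) S H x.
Proof.
rewrite /smooth meanS.
under eq_bexp do rewrite walk_cons add0r.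
under [X in (_ + X) / _]eq_bexp do rewrite walk_cons add0r.
lra.
Qed.

Lemma smooth_false n g S H x : smooth n.+1 g (false :: S) H x =
  smooth n (fun i => g i.+1) S (fun z => (H (z + g 0%N) + H (z - g 0%N)) / 2) x.
Proof.
rewrite /smooth meanS bexp_mid.
by congr ((_ + _) / _); apply: eq_bexp => l _; rewrite walk_cons/= addrA addrAC.
Qed.

(** Averaging over the signs outside S and sampling those inside S is the
exploration process of the function that H induces on the cube at x. The payoff
ignores the quadratic variation, so the initial y is arbitrary. *)
Lemma explore_smooth d n g H x y (k : R -> R) :
  bexp d n (fun S => mean n (fun e => k (smooth n g S H (x + walk n g true S e)))) =
  explore d (fun m _ => k m) n (fun e => H (x + vertex n g e)) y.
Proof.
have dbl (a : R) : (a + a) / 2 = a by lra.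
elim: n g H x y => [|n IH] g H x y.
  by rewrite /= /smooth /= /walk /vertex !big_ord0 !addr0.
rewrite bexpS; congr (_ * _ + _ * _).
  under eq_bexp => S _.
    rewrite meanS.
    under eq_bexp => e _ do rewrite smooth_true walk_cons/= addrA.
    under [X in (_ + X) / _]eq_bexp => e _ do rewrite smooth_true walk_cons/= addrA.
    over.
  rewrite bexp_mid; congr ((_ + _) / 2); apply: etrans (IH _ _ _ _) _.
    by congr explore; apply/funext => e; rewrite vertex_cons addrA.
  by congr explore; apply/funext => e; rewrite vertex_cons addrA.
under eq_bexp => S _.
  rewrite meanS.
  under eq_bexp => e _ do rewrite smooth_false walk_cons/= add0r.
  under [X in (_ + X) / _]eq_bexp => e _ do rewrite smooth_false walk_cons/= add0r.
  rewrite dbl.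
  over.
apply: etrans (IH _ _ _ _) _; congr explore; apply/funext => e.
by rewrite !vertex_cons/= !addrA ![x + _ + vertex _ _ _]addrAC.
Qed.

Lemma sum_shift (F : G -> R) a : \sum_x F (x + a) = \sum_x F x.
Proof. by rewrite [RHS](reindex_inj (addIr a)). Qed.

Lemma bexp_sum d n (I : finType) (F : I -> seq bool -> R) :
  bexp d n (fun l => \sum_i F i l) = \sum_i bexp d n (F i).
Proof.
elim: n F => [//|n IH] F /=; rewrite !IH !mulr_sumr -big_split/=.
by apply: eq_bigr.
Qed.

Lemma mean_flip n (f : seq bool -> R) : mean n (fun e => f (map negb e)) = mean n f.
Proof.
elim: n f => [//|n IH] f; rewrite !meanS /=.
by rewrite (IH (fun e => f (false :: e))) (IH (fun e => f (true :: e))) addrC.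
Qed.

Lemma walk_flip n g b S e : size e = n -> walk n g b S (map negb e) = - walk n g b S e.
Proof.
move=> en; rewrite /walk -sumrN; apply: eq_bigr => i _.
rewrite (nth_map false) ?en// /signed; case: ifP; rewrite ?oppr0// => _.
by case: (nth _ _ _); rewrite /= ?opprK.
Qed.

(** This quantity and the three that follow are the terms of the metric
inequality, summed over the group instead of averaged, as functionals of an
arbitrary kernel K. All four are linear in K, which is what the passage from real
functions to Lp needs. *)
Definition jumps d n g m (K : G -> G -> R) : R :=
  \sum_x bexp d n (fun S => mean n (fun e => K (x + walk n g true S e *+ m.*2) x)).

Definition smears d n g (K : G -> G -> R) : R :=
  \sum_x bexp d n (fun S => mean n (fun e => K x (x + walk n g false S e))).

Definition edges n g (K : G -> G -> R) : R :=
  \sum_x egrad n (fun e e' => K (x + vertex n g e) (x + vertex n g e')).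

Definition diagonals n g (K : G -> G -> R) : R :=
  \sum_x mean n (fun e => mean n (fun e' => K (x + vertex n g e) (x + vertex n g e'))).

Definition gap p H x y : R := `|H x - H y| `^ p.

Lemma gap_triangle p H T x y : 1 <= p ->
  gap p H x y <= 4 `^ p * (`|H x - T x| `^ p + gap p T x y + `|H y - T y| `^ p).
Proof.
move=> p1; rewrite /gap.
have -> : H x - H y = (H x - T x) + ((T x - T y) + (T y - H y)) by ring.
apply: le_trans (norm_powR_add _ _ _ _ p1) _.
rewrite (_ : 4 = 2 * 2); last by ring.
rewrite powRM//.
have := norm_powR_add _ _ (T x - T y) (T y - H y) p1.
rewrite -[`|T y - _|]normrN opprB.
set P := 2 `^ p; set A := `|H x - T x| `^ p => h.
have A0 : 0 <= A by exact: powR_ge0.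
have two : 1 <= P :> R.
  have /ler_powR/(_ 0 p) : 1 <= 2 :> R by lra.
  by rewrite powRr0; apply; lra.
have k1 : A <= P * A by rewrite ler_peMl.
rewrite -mulrA ler_wpM2l ?powR_ge0//; lra.
Qed.

(** A displacement by 2m v is a sum of m displacements by 2v. They all have the
same p-th moment because x is summed over the whole group, so the cost is
m^(p-1) times m. *)
Lemma telescope_shift p T (v : G) m : 1 <= p -> (0 < m)%N ->
  \sum_x gap p T (x + v *+ m.*2) x <= m%:R `^ p * \sum_x gap p T (x + v) (x - v).
Proof.
move=> p1 m0; have m0' : 0 < m%:R :> R by rewrite ltr0n.
rewrite -(ler_pM2l m0') mulr_sumr.
pose a x i := T (x + v *+ i.+1.*2) - T (x + v *+ i.*2).
have tel x : T (x + v *+ m.*2) - T x = \sum_(i < m) a x i.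
  rewrite -(big_mkord xpredT (a x)) (telescope_sumr (fun i => T (x + v *+ i.*2)))//.
  by rewrite mulr0n addr0.
apply: (@le_trans _ _ (\sum_x m%:R `^ p * \sum_(i < m) `|a x i| `^ p)).
  by apply: ler_sum => x _; rewrite /gap tel norm_powR_sum.
rewrite -mulr_sumr mulrCA ler_wpM2l ?powR_ge0// exchange_big/=.
rewrite (eq_bigr (fun=> \sum_x gap p T (x + v) (x - v))).
  by rewrite sumr_const card_ord mulr_natl.
move=> i _; rewrite -[RHS](sum_shift _ (v *+ (i.*2).+1)); apply: eq_bigr => x _.
rewrite /gap /a; congr (`|T _ - T _| `^ _).
  by rewrite doubleS [in LHS]mulrSr addrA.
by rewrite [in RHS]mulrSr -!addrA subrr addr0.
Qed.

Lemma smoothB n g S H c x : smooth n g S (fun z => H z - c) x = smooth n g S H x - c.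
Proof.
rewrite /smooth; rewrite (@eq_bexp _ _ _ _ (fun e => 1 * H (x + walk n g false S e) + (-1) * c)).
  by rewrite bexp_lin bexp_cst; ring.
by move=> e _; ring.
Qed.

Lemma mean_dist p n (f : seq bool -> R) c : 1 <= p ->
  `|c - mean n f| `^ p <= mean n (fun e => `|c - f e| `^ p).
Proof.
move=> p1; have [h0 h1] := @half01 R.
have -> : c - mean n f = mean n (fun e => 1 * c + (-1) * f e).
  by rewrite bexp_lin bexp_cst; ring.
apply: le_trans (@bexp_jensen _ _ _ _ _ h0 h1 p1) _.
by apply: le_bexp => // l _; rewrite mul1r mulN1r.
Qed.

End Sampling.

Section MetricXp.
Context {R : realType}.
Local Notation mean := (bexp 2^-1).

(** At fixed x, explored_moment applied to the function that H induces on the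
cube, centred at its mean. *)
Lemma smooth_concentration (p : R) : 2 < p -> exists2 C : R, 0 < C &
  forall (G : finZmodType) d n (g : nat -> G) (H : G -> R), 0 <= d -> d <= 1 ->
  \sum_x bexp d n (fun S => mean n (fun e =>
    `|smooth n g S H (x + walk n g true S e) - mean n (fun e' => H (x + vertex n g e'))| `^ p))
  <= C * (d * edges n g (gap p H) + d `^ (p / 2) * diagonals n g (gap p H)).
Proof.
move=> p2; have p1 : 1 <= p by lra.
have [C C0 hC] := @explored_moment R p p2; exists C => // G d n g H d0 d1.
have [h0 h1] := @half01 R.
rewrite /edges /diagonals !mulr_sumr -big_split/= mulr_sumr; apply: ler_sum => x _.
set c := mean n _; pose f e := H (x + vertex n g e) - c.
have f0 : mean n f = 0.
  rewrite (@eq_bexp _ _ _ _ (fun e => 1 * H (x + vertex n g e) + (-1) * c)).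
    by rewrite bexp_lin bexp_cst -/c; ring.
  by move=> e _; rewrite /f; ring.
have := hC d n f d0 d1 f0.
rewrite -(explore_smooth d n g (fun z => H z - c) x 0 (fun m => `|m| `^ p)).
under eq_bexp => S _ do under eq_bexp => e _ do rewrite smoothB.
move/le_trans; apply; rewrite ler_pM2l//; apply: lerD; apply: ler_wpM2l; rewrite ?powR_ge0//.
  by apply: le_egrad => l l'; rewrite /osc /f /gap opprB addrA subrK.
by apply: le_bexp => // e _; exact: mean_dist.
Qed.

(** H is compared with smooth S H at both ends of the jump, and 2v is split as the
difference of v and -v, so that both T_S H (x + v) and T_S H (x - v) can be
compared with the mean of H on the cube at x. *)
Lemma metric_Xp (p : R) : 2 < p -> exists2 C : R, 0 < C &
  forall (G : finZmodType) d n (g : nat -> G) m (H : G -> R), 0 <= d -> d <= 1 -> (0 < m)%N ->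
  jumps d n g m (gap p H) <= C * (smears d n g (gap p H) + m%:R `^ p *
    (d * edges n g (gap p H) + d `^ (p / 2) * diagonals n g (gap p H))).
Proof.
move=> p2; have p1 : 1 <= p by lra.
have [C C0 hC] := smooth_concentration p p2.
exists (4 `^ p * (2 + 2 * 2 `^ p * C)).
  by rewrite mulr_gt0 ?powR_gt0// addr_gt0// !mulr_gt0 ?powR_gt0.
move=> G d n g m H d0 d1 m0; have [h0 h1] := @half01 R.
have {hC} := hC G d n g H d0 d1.
pose B x := mean n (fun e' => H (x + vertex n g e')).
set Y := \sum_x _; set RY := _ + d `^ _ * _ => hY.
pose Z S e := \sum_x `|smooth n g S H (x + walk n g true S e) - B x| `^ p.
have YE : Y = bexp d n (fun S => mean n (Z S)).
  by rewrite /Y -bexp_sum; apply: eq_bexp => S _; rewrite -bexp_sum.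
pose W S := \sum_x `|H x - smooth n g S H x| `^ p.
have hW : bexp d n W <= smears d n g (gap p H).
  rewrite /smears -bexp_sum; apply: le_bexp => // S _.
  by apply: ler_sum => x _; exact: mean_dist.
have step S e : size e = n -> \sum_x gap p H (x + walk n g true S e *+ m.*2) x <=
    4 `^ p * (2 * W S + m%:R `^ p * (2 `^ p * (Z S e + Z S (map negb e)))).
  move=> en; set v := walk _ _ _ _ _; set T := smooth n g S H.
  apply: (@le_trans _ _ (\sum_x 4 `^ p * (`|H (x + v *+ m.*2) - T (x + v *+ m.*2)| `^ p +
      gap p T (x + v *+ m.*2) x + `|H x - T x| `^ p))).
    by apply: ler_sum => x _; exact: gap_triangle.
  rewrite -mulr_sumr ler_wpM2l ?powR_ge0// !big_split/=.
  rewrite (sum_shift (fun x => `|H x - T x| `^ p)) -/(W S).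
  have t1 := telescope_shift p T v m p1 m0.
  (* flipping all signs turns v into -v without changing the mean over e *)
  have t2 : \sum_x gap p T (x + v) (x - v) <= 2 `^ p * (Z S e + Z S (map negb e)).
    rewrite /Z -big_split/= mulr_sumr; apply: ler_sum => x _.
    rewrite walk_flip// -/v -/T -[`|T (x - v) - _|]normrN opprB.
    rewrite /gap (_ : T (x + v) - _ = (T (x + v) - B x) + (B x - T (x - v))); last by ring.
    exact: norm_powR_add.
  have := ler_wpM2l (powR_ge0 m%:R p) t2.
  lra.
have flip S : mean n (fun e => Z S (map negb e)) = mean n (Z S) by exact: mean_flip.
rewrite /jumps -bexp_sum.
apply: (@le_trans _ _ (bexp d n (fun S => (4 `^ p * 2) * W S +
    (4 `^ p * (m%:R `^ p * (2 `^ p * 2))) * mean n (Z S)))).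
  apply: le_bexp => // S _; rewrite -bexp_sum.
  apply: le_trans (le_bexp _ _ _ _ h0 h1 (step S)) _.
  rewrite (@eq_bexp _ _ _ _ (fun e => 1 * (4 `^ p * 2 * W S) + 4 `^ p * (m%:R `^ p * 2 `^ p) *
     (1 * Z S e + 1 * Z S (map negb e)))); last by move=> e _; ring.
  rewrite bexp_lin bexp_cst bexp_lin flip; lra.
rewrite bexp_lin -YE.
have Y0 : 0 <= RY.
  rewrite -(pmulr_rge0 _ C0); apply: le_trans hY.
  apply: sumr_ge0 => x _; rewrite -(@bexp_cst R d n 0); apply: le_bexp => // S _.
  rewrite -(@bexp_cst R 2^-1 n 0); apply: le_bexp => // e _; exact: powR_ge0.
have S0 : 0 <= smears d n g (gap p H).
  apply: sumr_ge0 => x _; rewrite -(@bexp_cst R d n 0); apply: le_bexp => // S _.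
  rewrite -(@bexp_cst R 2^-1 n 0); apply: le_bexp => // e _; exact: powR_ge0.
rewrite -!mulrA -mulrDr ler_wpM2l ?powR_ge0//.
have mp : 0 <= m%:R `^ p * (2 `^ p * 2) by rewrite !mulr_ge0 ?powR_ge0.
have k1 := ler_wpM2l mp hY.
have k2 : 0 <= 2 * 2 `^ p * C * smears d n g (gap p H).
  by rewrite !mulr_ge0 ?powR_ge0// ltW.
have k3 : 0 <= m%:R `^ p * RY by rewrite mulr_ge0 ?powR_ge0.
lra.
Qed.

End MetricXp.

(** * Transfer to Lp-valued functions *)

Section Transfer.
Context d (T : measurableType d) (R : realType) (mu : {measure set T -> \bar R}).

(** Packaging the value with integrability makes the class closed under linear
combinations without side conditions. *)
Definition has_int (g : T -> R) (v : R) :=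
  mu.-integrable setT (EFin \o g) /\ (\int[mu]_t (g t)%:E = v%:E)%E.

Lemma has_int_lin a b g h u v : has_int g u -> has_int h v ->
  has_int (fun t => a * g t + b * h t) (a * u + b * v).
Proof.
move=> [ig eg] [ih eh]; split.
  apply: (@eq_integrable _ _ _ mu _ _ ((fun t => a%:E * (EFin \o g) t) \+
    (fun t => b%:E * (EFin \o h) t))%E) => //.
  by apply: integrableD => //; exact: integrableZl.
under eq_integral do rewrite EFinD !EFinM.
rewrite integralD//; try exact: integrableZl.
by rewrite !integralZl// eg eh.
Qed.

Lemma has_int0 : has_int (fun=> 0) 0.
Proof. by split; [exact: integrable0|rewrite integral0]. Qed.

Lemma has_int_le g h u v : has_int g u -> has_int h v -> (forall t, g t <= h t) -> u <= v.
Proof.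
move=> [ig eg] [ih eh] gh; rewrite -lee_fin -eg -eh.
by apply: le_integral => // t _; rewrite lee_fin.
Qed.

Lemma has_int_eq g h u v : has_int g u -> g =1 h -> u = v -> has_int h v.
Proof. by move=> [ig eg] /funext <- <-. Qed.

Lemma has_int_sum (I : finType) (g : I -> T -> R) v : (forall i, has_int (g i) (v i)) ->
  has_int (fun t => \sum_i g i t) (\sum_i v i).
Proof.
move=> gv; elim: (index_enum I) => [|i s IH].
  by rewrite big_nil; apply: has_int_eq has_int0 _ _ => // t; rewrite big_nil.
rewrite big_cons; apply: has_int_eq (has_int_lin 1 1 _ _ _ _ (gv i) IH) _ _.
  by move=> t; rewrite big_cons !mul1r.
by rewrite !mul1r.
Qed.

Lemma has_int_bexp e n (g : seq bool -> T -> R) v : (forall l, has_int (g l) (v l)) ->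
  has_int (fun t => bexp e n (g^~ t)) (bexp e n v).
Proof.
elim: n g v => [|n IH] g v gv /=; first exact: gv.
by apply: has_int_lin; apply: (IH (fun l => g (_ :: l)) (fun l => v (_ :: l))) => l; exact: gv.
Qed.

Lemma has_int_egrad n (k : seq bool -> seq bool -> T -> R) v :
  (forall l l', has_int (k l l') (v l l')) ->
  has_int (fun t => egrad n (fun l l' => k l l' t)) (egrad n v).
Proof.
elim: n k v => [|n IH] k v kv /=; first exact: has_int0.
have h1 := has_int_bexp 2^-1 n (fun l => k (true :: l) (false :: l)) _ (fun l => kv (true :: l) (false :: l)).
have h2 := IH (fun l l' => k (true :: l) (true :: l')) _ (fun l l' => kv (true :: l) (true :: l')).
have h3 := IH (fun l l' => k (false :: l) (false :: l')) _ (fun l l' => kv (false :: l) (false :: l')).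
have h := has_int_lin 1 1 _ _ _ _ h1 (has_int_lin 2^-1 2^-1 _ _ _ _ h2 h3).
by apply: has_int_eq h _ _; [move=> t|]; rewrite !mul1r -mulrDr mulrC [in LHS]addrC [LHS]addrC; lra.
Qed.

End Transfer.
Arguments has_int {d T R} mu g v.
Arguments has_int_lin {d T R mu} a b {g h u v}.
Arguments has_int_le {d T R mu g h u v}.
Arguments has_int_eq {d T R mu g h u v}.
Arguments has_int0 {d T R mu}.
Arguments has_int_sum {d T R mu I g v}.
Arguments has_int_bexp {d T R mu} e n g {v}.
Arguments has_int_egrad {d T R mu} n k {v}.

Section LpTransfer.
Context {R : realType} (p : R) (p1 : (1 <= p%:E)%E).

Definition Lpgap (x y : Lp01 p1) : R := fine (Lpdist x y) `^ p.

Lemma has_int_gap (G : Type) (F : G -> Lp01 p1) x y :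
  has_int (lebesgue01 R) (fun t => `|(F x t : R) - F y t| `^ p) (Lpgap (F x) (F y)).
Proof.
have p1' : 1 <= p by rewrite -lee_fin.
have p0 : p != 0 by rewrite gt_eqF//; lra.
have e : (Lpdist (F x) (F y) `^ p = \int[lebesgue01 R]_t (`|(F x t : R) - F y t| `^ p)%:E)%E.
  by rewrite /Lpdist poweR_Lnorm.
have mF z : measurable_fun setT (fun t => F z t : R).
  exact: (@measurable_funPT _ _ _ _ (repr (F z : {mfun_ lebesgue01 R, _ >-> _}))).
have m : measurable_fun setT (fun t => (F x t : R) - F y t) by exact: measurable_funB.
have fin : (Lpdist (F x) (F y) < +oo)%E.
  rewrite /Lpdist; have mN : measurable_fun setT (fun t => - (F y t : R)).
    by apply: measurableT_comp (mF y).
  apply: le_lt_trans (eminkowski _ (mF x) mN p1) _.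
  rewrite lte_add_pinfty//; first exact: Lebesgue_finite.
  rewrite (_ : EFin \o _ = (\- (EFin \o (fun t => (F y t : R))))%E); last by [].
  apply: (@le_lt_trans _ _ (Lnorm (lebesgue01 R) p%:E (EFin \o (fun t => (F y t : R))))); last exact: Lebesgue_finite.
  by rewrite oppe_Lnorm.
have ge0 : (0 <= Lpdist (F x) (F y))%E by exact: Lnorm_ge0.
have fn : Lpdist (F x) (F y) \is a fin_num by rewrite ge0_fin_numE.
have i : (\int[lebesgue01 R]_t (`|(F x t : R) - F y t| `^ p)%:E = (Lpgap (F x) (F y))%:E)%E.
  by rewrite -e /Lpgap -poweR_EFin fineK.
split => //; apply/integrableP; split.
  apply/measurable_EFinP; apply: (measurableT_comp (measurable_powR _)) => //.
  exact: measurableT_comp.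
under eq_integral do rewrite /= ger0_norm ?powR_ge0//.
by rewrite i ltry.
Qed.

Lemma metric_Xp_Lp : 2 < p -> exists2 C : R, 0 < C &
  forall (G : finZmodType) d n (g : nat -> G) m (F : G -> Lp01 p1),
  let K x y := Lpgap (F x) (F y) in 0 <= d -> d <= 1 -> (0 < m)%N ->
  jumps d n g m K <= C * (smears d n g K + m%:R `^ p *
    (d * edges n g K + d `^ (p / 2) * diagonals n g K)).
Proof.
move=> p2; have [C C0 hC] := @metric_Xp R p p2; exists C => // G d n g m F K d0 d1 m0.
pose Kt x y t := gap p (fun z => F z t : R) x y.
have hK x y : has_int (lebesgue01 R) (Kt x y) (K x y) by exact: has_int_gap.
have h1 : has_int (lebesgue01 R) (fun t => jumps d n g m (fun x y => Kt x y t)) (jumps d n g m K).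
  apply: has_int_sum => x.
  apply: (has_int_bexp _ _ (fun S t => bexp 2^-1 n (fun e => Kt (x + walk n g true S e *+ m.*2) x t))) => S.
  by apply: (has_int_bexp _ _ (fun e t => Kt (x + walk n g true S e *+ m.*2) x t)).
have h2 : has_int (lebesgue01 R) (fun t => smears d n g (fun x y => Kt x y t)) (smears d n g K).
  apply: has_int_sum => x.
  apply: (has_int_bexp _ _ (fun S t => bexp 2^-1 n (fun e => Kt x (x + walk n g false S e) t))) => S.
  by apply: (has_int_bexp _ _ (fun e t => Kt x (x + walk n g false S e) t)).
have h3 : has_int (lebesgue01 R) (fun t => edges n g (fun x y => Kt x y t)) (edges n g K).
  apply: has_int_sum => x.
  by apply: (has_int_egrad _ (fun e e' t => Kt (x + vertex n g e) (x + vertex n g e') t)).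
have h4 : has_int (lebesgue01 R) (fun t => diagonals n g (fun x y => Kt x y t)) (diagonals n g K).
  apply: has_int_sum => x.
  apply: (has_int_bexp _ _ (fun S t => bexp 2^-1 n (fun e => Kt (x + vertex n g S) (x + vertex n g e) t))) => S.
  by apply: (has_int_bexp _ _ (fun e t => Kt (x + vertex n g S) (x + vertex n g e) t)).
have h34 := has_int_lin d (d `^ (p / 2)) h3 h4.
have hR := has_int_lin C (C * m%:R `^ p) h2 h34.
rewrite mulrDr mulrA; apply: has_int_le h1 hR _ => t.
by rewrite -mulrA -mulrDr; apply: hC.
Qed.

End LpTransfer.

(** * Finite-dimensional step functions in Lp *)

(** The elements of Lp01 are applied through representatives of which only the
class is known, so norms are computed after an almost everywhere replacement. *)
Lemma ae_eq_Lnorm d (T : measurableType d) (R : realType) (mu : {measure set T -> \bar R})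
    (p : R) (f g : T -> R) :
  measurable_fun setT f -> measurable_fun setT g -> f = g %[ae mu] ->
  Lnorm mu p%:E (EFin \o f) = Lnorm mu p%:E (EFin \o g).
Proof.
move=> mf mg fg; rewrite unlock; congr (_ `^ _)%E.
have m (h : T -> R) : measurable_fun setT h -> measurable_fun setT (fun x => `|(h x)%:E| `^ p)%E.
  move=> mh; under eq_fun do rewrite abse_EFin poweR_EFin.
  apply/measurable_EFinP; apply: (measurableT_comp (measurable_powR _)) => //.
  exact: measurableT_comp.
apply: ae_eq_integral => //; [exact: m|exact: m|].
by apply: filterS fg => x /= + _ => /(_ I) ->.
Qed.

Section Steps.
Context {R : realType} (p : R) (p1 : (1 <= p%:E)%E).
Local Notation mu := (lebesgue01 R).
Local Notation T := (measurableTypeR R).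
Local Open Scope quotient_scope.

Lemma Lp01_rep (g : {mfun T >-> T}) : finite_norm mu p%:E (g : T -> R) ->
  exists x : Lp01 p1, (fun t => x t : R) = (g : T -> R) %[ae mu].
Proof.
move=> fg; pose x0 : {mfun_ mu, T >-> T} := \pi_({mfun_ mu, T >-> T}) g.
have x0g : (repr x0 : T -> R) = g %[ae mu].
  have : (repr x0 == g %[mod {mfun_ mu, T >-> T}]) by rewrite reprK.
  by rewrite eqmodE => /asboolP.
have fx : finite_norm mu p%:E (x0 : T -> R).
  rewrite /finite_norm (ae_eq_Lnorm _ _ _ _ _ _ (g : T -> R))//.
  exact: (measurable_funPT (repr x0)).
  exact: (measurable_funPT g).
pose m := @isFinLebesgue.Build _ _ _ mu p%:E p1 x0 fx.
pose x : Lp01 p1 := HB.pack x0 m.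
by exists x.
Qed.

Definition cell (I : finType) (i : I) : set T :=
  `[((enum_rank i)%:R / #|I|%:R : R), ((enum_rank i).+1%:R / #|I|%:R : R)[%classic.

Definition step (I : finType) (a : I -> R) (t : T) : R := \sum_i a i * \1_(cell I i) t.

Lemma card_gt0R (I : finType) (i : I) : 0 < #|I|%:R :> R.
Proof. by rewrite ltr0n; apply/card_gt0P; exists i. Qed.

Lemma cell_inj (I : finType) (i j : I) t : t \in cell I i -> t \in cell I j -> i = j.
Proof.
have D0 := card_gt0R I i.
rewrite !inE /cell /= !in_itv/= => /andP[a1 a2] /andP[b1 b2].
have := le_lt_trans a1 b2; have := le_lt_trans b1 a2.
rewrite !ltr_pM2r ?invr_gt0// !ltr_nat !ltnS => h1 h2.
by apply: enum_rank_inj; apply/val_inj/eqP; rewrite eqn_leq h1 h2.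
Qed.

(** The cells are disjoint, so at each point at most one term of the sum is
nonzero. *)
Lemma step_comp (I : finType) (a : I -> R) (phi : R -> R) t : phi 0 = 0 ->
  phi (step I a t) = step I (phi \o a) t.
Proof.
move=> phi0; rewrite /step.
have [[i ti]|no] := pselect (exists i, t \in cell I i).
  have z (b : I -> R) : \sum_j b j * \1_(cell I j) t = b i.
    rewrite (bigD1 i)//= indicE ti mulr1 big1 ?addr0// => j ji.
    rewrite indicE; case: (boolP (t \in _)) => [tj|_]; last by rewrite mulr0.
    by rewrite (cell_inj _ _ _ _ ti tj) eqxx in ji.
  by rewrite !z.
have z (b : I -> R) : \sum_j b j * \1_(cell I j) t = 0.
  rewrite big1// => j _; rewrite indicE; case: (boolP (t \in _)) => [tj|_]; last by rewrite mulr0.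
  by exfalso; apply: no; exists j.
by rewrite !z.
Qed.

Lemma measurable_cell (I : finType) (i : I) : measurable (cell I i).
Proof. exact: measurable_itv. Qed.

Lemma mu_cell (I : finType) (i : I) : mu (cell I i) = (#|I|%:R^-1)%:E.
Proof.
have D0 := card_gt0R I i.
rewrite (_ : mu _ = @lebesgue_measure R (cell I i `&` `[0, 1]))// setIidl; last first.
  move=> t; rewrite /cell /= !in_itv/= => /andP[a1 /ltW a2]; apply/andP; split.
    by apply: le_trans a1; rewrite divr_ge0.
  apply: le_trans a2 _; rewrite ler_pdivrMr// mul1r ler_nat; exact: ltn_ord.
rewrite /cell lebesgue_measure_itv/= lte_fin ltr_pM2r ?invr_gt0// ltr_nat ltnSn.
by rewrite -EFinB -mulrBl -natrB// subSnn mul1r.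
Qed.

Lemma has_int_step (I : finType) (a : I -> R) :
  has_int mu (step I a) (\sum_i a i / #|I|%:R).
Proof.
apply: has_int_sum => i.
have h : has_int mu (\1_(cell I i) : T -> R) (#|I|%:R^-1).
  have e : (\int[mu]_t (\1_(cell I i) t)%:E = (#|I|%:R^-1)%:E)%E.
    by rewrite integral_indic ?setIT ?mu_cell//; exact: measurable_cell.
  split=> //; apply/integrableP; split.
    by apply/measurable_EFinP; exact: measurable_indic (measurable_cell _ _).
  by under eq_integral do rewrite /= ger0_norm//; rewrite e ltry.
by apply: has_int_eq (has_int_lin (a i) 0 h has_int0) _ _; [move=> t|]; rewrite mulr0 addr0.
Qed.
Lemma measurable_step (I : finType) (a : I -> R) : measurable_fun setT (step I a).
Proof.
apply: measurable_sum => i; apply: measurable_funM => //.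
exact: measurable_indic (measurable_cell _ _).
Qed.

Lemma Lnorm_step (I : finType) (a : I -> R) :
  Lnorm mu p%:E (EFin \o step I a) = ((\sum_i `|a i| `^ p / #|I|%:R) `^ p^-1)%:E.
Proof.
have p0 : 0 < p by apply: (@lt_le_trans _ _ 1) => //; rewrite -lee_fin.
rewrite unlock -poweR_EFin; congr (_ `^ _)%E.
have [_ <-] := has_int_step I (fun i => `|a i| `^ p).
apply: eq_integral => t _ /=; rewrite (step_comp _ _ (fun r => `|r| `^ p))//.
by rewrite normr0 powR0// gt_eqF.
Qed.

(** A copy in Lp of a finite-dimensional l_p with normalized counting measure;
the points of the torus are constructed there. *)
Lemma Lp01_embed (I : finType) : exists e : (I -> R) -> Lp01 p1,
  (forall a, Lpnorm (e a) = ((\sum_i `|a i| `^ p / #|I|%:R) `^ p^-1)%:E) /\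
  (forall a b, Lpdist (e a) (e b) = ((\sum_i `|a i - b i| `^ p / #|I|%:R) `^ p^-1)%:E).
Proof.
have ex a : exists x : Lp01 p1, (fun t => x t : R) = step I a %[ae mu].
  pose m := @isMeasurableFun.Build _ _ T T (step I a) (measurable_step I a).
  pose g : {mfun T >-> T} := HB.pack (step I a : T -> T) m.
  by apply: (Lp01_rep g); rewrite /finite_norm Lnorm_step ltry.
have me (x : Lp01 p1) : measurable_fun setT (fun t => x t : R).
  exact: (@measurable_funPT _ _ _ _ (repr (x : {mfun_ mu, _ >-> _}))).
pose e a := sval (cid (ex a)).
have he a : (fun t => e a t : R) = step I a %[ae mu] by exact: svalP (cid (ex a)).
exists e; split=> [a|a b].
  by rewrite -Lnorm_step; apply: ae_eq_Lnorm => //; exact: measurable_step.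
rewrite -Lnorm_step; apply: ae_eq_Lnorm; [exact: measurable_funB|exact: measurable_step|].
have -> : step I (fun i => a i - b i) = (fun t => step I a t - step I b t).
  by apply/funext => t; rewrite /step -sumrB; apply: eq_bigr => i _; rewrite mulrBl.
by apply: filterS2 (he a) (he b) => t /= h1 h2 _; rewrite h1// h2.
Qed.
End Steps.

(** * The triangle wave *)

Section Wave.
Context (k : nat).
Local Notation P := (4 * k + 3)%N.
Local Notation Z := 'I_P.+1.

Definition unitZ : Z := inZp 1.

Lemma val_add_unitZ c (z : Z) : nat_of_ord (z + unitZ *+ c) = ((z + c) %% P.+1)%N.
Proof.
elim: c => [|c IH]; first by rewrite mulr0n addr0 addn0 modn_small.
rewrite mulrSr addrA.
have -> (y : Z) : nat_of_ord (y + unitZ) = ((y + 1) %% P.+1)%N by rewrite /= modnDmr.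
by rewrite IH modnDml -addnA addn1.
Qed.

(** The triangle wave of period 4(k+1) on residues 0, ..., 4k+3: it decreases
from k+1 to -(k+1) on the first half period and increases back on the
second. *)
Definition wavez (z : nat) : int :=
  if (z <= 2 * k.+1)%N then k.+1%:Z - z%:Z else z%:Z - 3 * k.+1%:Z.

Lemma mod_cases c (z : nat) : (z < P.+1)%N -> (c <= P.+1)%N ->
  ((z + c) %% P.+1)%N = if (z + c < P.+1)%N then (z + c)%N else (z + c - P.+1)%N.
Proof.
move=> zP cP; case: ltnP => h; first by rewrite modn_small.
by rewrite -[in LHS](subnK h) modnDr modn_small//; lia.
Qed.

Lemma wavez_half (z : Z) : wavez (z + unitZ *+ k.+1.*2)%R = - wavez z.
Proof.
rewrite /wavez val_add_unitZ mod_cases ?ltn_ord//; last by lia.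
have := ltn_ord z; move: (nat_of_ord z) => a aP.
by case: (ltnP (a + _)%N P.+1) => ?; do 2 case: ifP => ?; lia.
Qed.

Lemma wavez_step (z : Z) : `|wavez (z + unitZ)%R - wavez z| <= 1.
Proof.
have h := val_add_unitZ 1 z; rewrite mulr1n in h.
rewrite /wavez h mod_cases ?ltn_ord//.
have := ltn_ord z; move: (nat_of_ord z) => a aP.
by case: (ltnP (a + _)%N P.+1) => ?; do 2 case: ifP => ?; lia.
Qed.

Lemma wavez_quarter (z : Z) : k.+1%:Z <= `|wavez z| + `|wavez (z + unitZ *+ k.+1)%R|.
Proof.
rewrite /wavez val_add_unitZ mod_cases ?ltn_ord//; last by lia.
have := ltn_ord z; move: (nat_of_ord z) => a aP.
by case: (ltnP (a + _)%N P.+1) => ?; do 2 case: ifP => ?; lia.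
Qed.

Section Real.
Context (R : realType).

Definition triangle_wave (z : Z) : R := (wavez z)%:~R.

Lemma wave_half z : triangle_wave (z + unitZ *+ k.+1.*2) = - triangle_wave z.
Proof. by rewrite /triangle_wave wavez_half mulrNz. Qed.

Lemma wave_step z : `|triangle_wave (z + unitZ) - triangle_wave z| <= 1.
Proof. by rewrite /triangle_wave -intrB -intr_norm lerz1 wavez_step. Qed.

End Real.
End Wave.

(** * A discrete torus on the unit sphere *)

Section TorusPoints.
Context (k : nat).
Local Notation P := (4 * k + 3)%N.
Local Notation Z := 'I_P.+1.
Local Notation u := (unitZ k).
Context (R : realType).
Local Notation wave := (triangle_wave k R).

(** Where the wave is small, it is large a quarter of a period later; this bounds
its q-norm from below by a multiple of k+1. *)
Lemma wave_quarter z : k.+1%:R <= `|wave z| + `|wave (z + u *+ k.+1)|.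
Proof. by rewrite /triangle_wave -!intr_norm -intrD -[leLHS]/(k.+1%:~R) ler_int wavez_quarter. Qed.

(** Displacements of at most two steps, stated through their effect on the
wave. *)
Definition small (v : Z) := forall z, `|wave (z + v) - wave z| <= 2.

Lemma small0 : small 0.
Proof. by move=> z; rewrite addr0 subrr normr0. Qed.

Lemma small_unit : small u.
Proof. by move=> z; apply: le_trans (wave_step _ _ _) _; rewrite ler1n. Qed.

Lemma smallN v : small v -> small (- v).
Proof. by move=> h z; have := h (z - v); rewrite subrK distrC. Qed.

Lemma small_unit2 : small (u + u).
Proof.
move=> z; rewrite addrA.
rewrite (_ : _ - _ = (wave (z + u + u) - wave (z + u)) + (wave (z + u) - wave z)); last by ring.
apply: le_trans (ler_normD _ _) _.
have := wave_step k R (z + u); have := wave_step k R z; lra.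
Qed.

Context (n : nat).
Local Notation G := 'rV[Z]_n.

Definition unit_row (j : nat) : G := \row_(i < n) (if val i == j then u else 0).

Lemma signed_row j t (i : 'I_n) : signed unit_row j t 0 i = if val i == j then (if t then u else - u) else 0.
Proof. by case: t; rewrite /signed !mxE//; case: ifP; rewrite ?oppr0. Qed.

Lemma walk_row b S e (i : 'I_n) : walk n unit_row b S e 0 i =
  if nth false S i == b then (if nth false e i then u else - u) else 0.
Proof.
rewrite /walk summxE (bigD1 i)//= big1 ?addr0 => [|j ji].
  by case: ifP => _; rewrite ?mxE// signed_row eqxx.
by case: ifP => _; rewrite ?mxE// signed_row (_ : (val i == val j) = false)//; apply/negbTE; rewrite eq_sym.
Qed.

Lemma vertex_row e (i : 'I_n) : vertex n unit_row e 0 i = if nth false e i then u else - u.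
Proof.
rewrite /vertex summxE (bigD1 i)//= big1 ?addr0 => [|j ji]; first by rewrite signed_row eqxx.
by rewrite signed_row (_ : (val i == val j) = false)//; apply/negbTE; rewrite eq_sym.
Qed.

Lemma half_turn (b : bool) z : wave (z + (if b then u else - u) *+ k.+1.*2) = - wave z.
Proof.
case: b; first exact: wave_half.
have := wave_half k R (z + (- u) *+ k.+1.*2).
by rewrite mulNrn subrK => ->; rewrite opprK.
Qed.

(** D is the q-th power of the distance. It is additive over the n coordinates,
and each coordinate contributes the sum of a translate of the wave, so that norms
do not depend on the point and half-turns are computed exactly. *)
Lemma sphere_torus (q : R) (q1 : (1 <= q%:E)%E) : (0 < n)%N ->
  exists (U : G -> Lp01 q1) (D : G -> G -> R),
  [/\ forall x : G, Lpnorm (U x) = 1%E,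
      forall x y : G, Lpdist (U x) (U y) = (D x y `^ q^-1)%:E /\ 0 <= D x y,
      forall (x : G) S e, D (x + walk n unit_row true S e *+ k.+1.*2) x =
        2 `^ q * (\sum_(j < n) (nth false S j)%:R / n%:R) &
      forall x y : G, (forall j, small (y 0 j - x 0 j)) ->
        D x y <= (8 / k.+1%:R) `^ q * (\sum_(j < n) (x 0 j != y 0 j)%:R / n%:R)].
Proof.
move=> n0; have q1' : 1 <= q by rewrite -lee_fin.
have q0 : 0 < q by lra.
have n0' : 0 < n%:R :> R by rewrite ltr0n.
pose N : R := #|{: Z}|%:R.
have N0 : 0 < N by rewrite ltr0n card_ord.
pose W := \sum_z `|wave z| `^ q.
have W2 : N * (k.+1%:R / 2) `^ q <= 2 * W.
  have -> : 2 * W = \sum_z (`|wave z| `^ q + `|wave (z + u *+ k.+1)| `^ q).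
    by rewrite big_split/= (sum_shift (fun z => `|wave z| `^ q)) -/W; ring.
  rewrite /N mulr_natl -sumr_const; apply: ler_sum => z _.
  have := wave_quarter z; set a := `|wave z|; set b := `|wave (_ + _)| => ab.
  have a0 : 0 <= a := normr_ge0 _; have b0 : 0 <= b := normr_ge0 _.
  have [h|h] := leP (k.+1%:R / 2) a.
    apply: (@le_trans _ _ (a `^ q)); last by rewrite lerDl powR_ge0.
    by apply: ge0_ler_powR; rewrite ?nnegrE ?divr_ge0 ?(ltW q0).
  apply: (@le_trans _ _ (b `^ q)); last by rewrite lerDr powR_ge0.
  by apply: ge0_ler_powR; rewrite ?nnegrE ?divr_ge0 ?(ltW q0)//; lra.
have k0 : 0 < k.+1%:R :> R by rewrite ltr0n.
have W0 : 0 < W.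
  have : 0 < N * (k.+1%:R / 2) `^ q by rewrite mulr_gt0 ?powR_gt0// divr_gt0.
  lra.
(* normalization: the mean of the q-th powers of c * wave is 1 *)
pose c := (N / W) `^ q^-1.
have c0 : 0 <= c by exact: powR_ge0.
have cq : c `^ q = N / W.
  by rewrite -powRrM mulVf ?gt_eqF// powRr1// divr_ge0 ?ltW.
have cle : c `^ q <= (4 / k.+1%:R) `^ q.
  rewrite cq ler_pdivrMr//.
  have e2 : (k.+1%:R / 2) `^ q * (4 / k.+1%:R) `^ q = 2 `^ q :> R.
    rewrite -powRM ?divr_ge0//; congr (_ `^ _); field; exact: lt0r_neq0.
  have two : 2 <= 2 `^ q :> R by apply: le1r_powR => //; rewrite ler1n.
  have X0 : 0 <= (4 / k.+1%:R : R) `^ q by exact: powR_ge0.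
  have := ler_wpM2r X0 W2; rewrite -mulrA e2 => h1.
  have := ler_wpM2l (ltW N0) two.
  lra.
have [E [En Ed]] := Lp01_embed q q1 ('I_n * Z)%type.
pose a (x : G) (i : 'I_n * Z) := c * wave (x 0 i.1 + i.2).
pose D x y := \sum_i `|a x i - a y i| `^ q / #|{: 'I_n * Z}|%:R.
have cI : #|{: 'I_n * Z}|%:R = n%:R * N :> R by rewrite card_prod natrM card_ord.
exists (fun x => E (a x)), D; split.
- move=> x; rewrite En.
  suff -> : \sum_i `|a x i| `^ q / #|{: 'I_n * Z}|%:R = 1 by rewrite powR1.
  rewrite cI -mulr_suml.
  rewrite -(pair_bigA _ (fun j z => `|a x (j, z)| `^ q))/=.
  rewrite (eq_bigr (fun=> c `^ q * W)); last first.
    move=> j _; rewrite /W mulr_sumr -(sum_shift (fun z => c `^ q * _) (x 0 j)).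
    apply: eq_bigr => z _; rewrite /a/= normrM (ger0_norm c0) powRM// addrC.
    by rewrite addrC.
  rewrite sumr_const card_ord cq -mulr_natl; field.
  by rewrite !lt0r_neq0.
- by move=> x y; rewrite Ed; split=> //; apply: sumr_ge0 => i _; rewrite divr_ge0 ?powR_ge0.
- move=> x S e; rewrite /D cI -!mulr_suml.
  rewrite -(pair_bigA _ (fun j z => `|a _ (j, z) - a x (j, z)| `^ q))/=.
  rewrite (eq_bigr (fun j : 'I_n => (nth false S j)%:R * (c `^ q * (2 `^ q * W)))).
    rewrite -mulr_suml cq; field.
    by rewrite !lt0r_neq0.
  move=> j _; rewrite /a/=.
  have addx (v : G) : (x + v) 0 j = x 0 j + v 0 j by rewrite mxE.
  have mulmxn (v : G) t : (v *+ t) 0 j = v 0 j *+ t.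
    by elim: t => [|t IH]; rewrite ?mulr0n ?mxE// !mulrS mxE IH.
  rewrite addx mulmxn walk_row; case: (nth false S j) => /=; last first.
    by rewrite mul0rn addr0 mul0r big1// => z _; rewrite subrr normr0 powR0// gt_eqF.
  rewrite mul1r /W !mulr_sumr -(sum_shift (fun z => c `^ q * _) (x 0 j)).
  apply: eq_bigr => z _; rewrite addrAC half_turn (addrC z).
  rewrite (_ : _ - _ = (- 2 * c) * wave (x 0 j + z)); last by ring.
  rewrite !normrM normrN (ger0_norm c0) (@ger0_norm _ 2)// !powRM ?mulr_ge0//; ring.
- move=> x y sm; rewrite /D cI -!mulr_suml.
  rewrite -(pair_bigA _ (fun j z => `|a x (j, z) - a y (j, z)| `^ q))/=.
  apply: (@le_trans _ _ ((\sum_(j < n) (x 0 j != y 0 j)%:R * (c `^ q * 2 `^ q * N)) / (n%:R * N))).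
    rewrite ler_pM2r ?invr_gt0 ?mulr_gt0//; apply: ler_sum => j _.
    have [xy|xy] := eqVneq (x 0 j) (y 0 j).
      by rewrite mul0r /a/= xy big1// => z _; rewrite subrr normr0 powR0// gt_eqF.
    rewrite mul1r /N mulr_natr -sumr_const; apply: ler_sum => z _.
    rewrite /a/= -mulrBr -powRM//; apply: ge0_ler_powR; rewrite ?nnegrE ?mulr_ge0 ?(ltW q0)//.
    rewrite normrM (ger0_norm c0) ler_wpM2l//.
    have := sm j (x 0 j + z); rewrite distrC.
    by rewrite (_ : x 0 j + z + _ = y 0 j + z)// addrC addrA subrK.
  rewrite -mulr_suml.
  rewrite (_ : _ * _ / _ = c `^ q * 2 `^ q * ((\sum_(j < n) (x 0 j != y 0 j)%:R) / n%:R)); last first.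
    by field; rewrite !lt0r_neq0.
  rewrite ler_wpM2r ?divr_ge0 ?sumr_ge0//.
  apply: le_trans (ler_wpM2r (powR_ge0 _ _) cle) _.
  rewrite -powRM ?divr_ge0// le_eqVlt; apply/orP; left; apply/eqP; congr (_ `^ _); field.
  exact: lt0r_neq0.
Qed.
End TorusPoints.

(** * The bound on the exponent *)

Lemma egrad_le (R : realType) n (k : seq bool -> seq bool -> R) B :
  (forall l1 l2, (size l1 + size l2).+1 = n -> k (l1 ++ true :: l2) (l1 ++ false :: l2) <= B) ->
  egrad n k <= n%:R * B.
Proof.
have [h0 h1] := @half01 R.
elim: n k => [|n IH] k hk; first by rewrite /= mul0r.
rewrite /=.
have i1 := IH (fun l l' => k (true :: l) (true :: l')) (fun l1 l2 e => hk (true :: l1) l2 (congr1 succn e)).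
have i2 := IH (fun l l' => k (false :: l) (false :: l')) (fun l1 l2 e => hk (false :: l1) l2 (congr1 succn e)).
have : bexp 2^-1 n (fun l => k (true :: l) (false :: l)) <= B.
  rewrite -[leRHS](@bexp_cst R 2^-1 n); apply: le_bexp => // l sl.
  by apply: (hk [::] l); rewrite add0n sl.
rewrite -[n.+1]addn1 natrD; lra.
Qed.

Lemma bexp_nth (R : realType) d n j : (j < n)%N ->
  bexp d n (fun S => (nth false S j)%:R) = d :> R.
Proof.
elim: n j => [//|n IH] [|j] jn; rewrite bexpS /=; first by rewrite !bexp_cst; ring.
by rewrite IH//; ring.
Qed.

Section TorusBounds.
Context {R : realType} (k n : nat).
Local Notation G := 'rV['I_(4 * k + 3).+1]_n.
Local Notation g := (unit_row k n).

(** Jensen's inequality for t^s: the mean proportion of the indices in S is d. *)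
Lemma jumps_ge (d s c : R) (K : G -> G -> R) : 0 <= d -> d <= 1 -> 1 <= s -> 0 <= c -> (0 < n)%N ->
  (forall x S e, (c * (\sum_(j < n) (nth false S j)%:R / n%:R)) `^ s <=
     K (x + walk n g true S e *+ k.+1.*2) x) ->
  #|G|%:R * (c * d) `^ s <= jumps d n g k.+1 K.
Proof.
move=> d0 d1 s1 c0 n0 hK; have [h0 h1] := @half01 R.
rewrite /jumps mulr_natl -sumr_const; apply: ler_sum => x _.
pose f (S : seq bool) : R := c * (\sum_(j < n) (nth false S j)%:R / n%:R).
have -> : c * d = bexp d n f.
  rewrite (@eq_bexp _ _ _ _ (fun S => (c / n%:R) * (\sum_(j < n) (nth false S j)%:R) + 0 * 0)).
    rewrite (bexp_lin d n _ _ _ (fun=> 0)) bexp_sum mul0r addr0.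
    rewrite (eq_bigr (fun=> d)) => [|j _]; last exact: bexp_nth.
    rewrite sumr_const card_ord -mulr_natl; field.
    by rewrite pnatr_eq0 -lt0n.
  by move=> S _; rewrite /f -mulr_suml; ring.
have f0 S : 0 <= f S by rewrite mulr_ge0// sumr_ge0// => j _; rewrite divr_ge0.
rewrite -[bexp d n f]ger0_norm; last first.
  by rewrite -(@bexp_cst R d n 0); apply: le_bexp.
apply: le_trans (bexp_jensen _ _ _ _ d0 d1 s1) _; apply: le_bexp => // S _.
rewrite -[leLHS](@bexp_cst R 2^-1 n); apply: le_bexp => // e _.
by rewrite ger0_norm//; exact: hK.
Qed.

Lemma smears_le (d B : R) (K : G -> G -> R) : 0 <= d -> d <= 1 ->
  (forall x S e, K x (x + walk n g false S e) <= B) -> smears d n g K <= #|G|%:R * B.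
Proof.
move=> d0 d1 hK; have [h0 h1] := @half01 R.
rewrite /smears mulr_natl -sumr_const; apply: ler_sum => x _.
rewrite -[leRHS](@bexp_cst R d n); apply: le_bexp => // S _.
by rewrite -[leRHS](@bexp_cst R 2^-1 n); apply: le_bexp.
Qed.

Lemma edges_le (B : R) (K : G -> G -> R) :
  (forall x l1 l2, K (x + vertex n g (l1 ++ true :: l2)) (x + vertex n g (l1 ++ false :: l2)) <= B) ->
  edges n g K <= #|G|%:R * (n%:R * B).
Proof.
move=> hK; rewrite /edges mulr_natl -sumr_const; apply: ler_sum => x _.
by apply: egrad_le => l1 l2 _.
Qed.

Lemma diagonals_le (B : R) (K : G -> G -> R) :
  (forall x e e', K (x + vertex n g e) (x + vertex n g e') <= B) ->
  diagonals n g K <= #|G|%:R * B.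
Proof.
move=> hK; have [h0 h1] := @half01 R.
rewrite /diagonals mulr_natl -sumr_const; apply: ler_sum => x _.
rewrite -[leRHS](@bexp_cst R 2^-1 n); apply: le_bexp => // S _.
by rewrite -[leRHS](@bexp_cst R 2^-1 n); apply: le_bexp.
Qed.

Lemma small_walk b S e (x : G) (j : 'I_n) : small k R ((x + walk n g b S e) 0 j - x 0 j).
Proof.
rewrite mxE addrC addKr walk_row; case: ifP => _; last exact: small0.
by case: (nth _ _ _); [|apply: smallN]; exact: small_unit.
Qed.

Lemma small_vertex e e' (x : G) (j : 'I_n) :
  small k R ((x + vertex n g e') 0 j - (x + vertex n g e) 0 j).
Proof.
rewrite !mxE opprD addrACA subrr add0r !vertex_row.
case: (nth _ _ _); case: (nth _ _ _); rewrite ?opprK.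
- by rewrite subrr; exact: small0.
- exact: small_unit2.
- by rewrite -opprD; apply: smallN; exact: small_unit2.
- by rewrite addrC subrr; exact: small0.
Qed.

Lemma changed_le1 (x y : G) : (0 < n)%N ->
  \sum_(j < n) (x 0 j != y 0 j)%:R / n%:R <= 1 :> R.
Proof.
move=> n0; rewrite -mulr_suml ler_pdivrMr ?ltr0n// mul1r -natr_sum ler_nat.
rewrite -[leqRHS]card_ord -sum1_card; apply: leq_sum => j _; exact: leq_b1.
Qed.

(** The end points of an edge of the cube differ in the coordinate size l1
only. *)
Lemma changed_edge (x : G) l1 l2 : (0 < n)%N ->
  \sum_(j < n) ((x + vertex n g (l1 ++ true :: l2)) 0 j !=
    (x + vertex n g (l1 ++ false :: l2)) 0 j)%:R / n%:R <= n%:R^-1 :> R.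
Proof.
move=> n0; rewrite -mulr_suml ler_pdivrMr ?ltr0n// mulVf ?pnatr_eq0 -?lt0n//.
have same (j : 'I_n) : val j != size l1 ->
    (x + vertex n g (l1 ++ true :: l2)) 0 j = (x + vertex n g (l1 ++ false :: l2)) 0 j.
  move=> jl; rewrite !mxE !vertex_row !nth_cat; case: ltnP => // lj.
  case E : (j - size l1)%N => [|i]//=.
  by move: jl; rewrite eqn_leq lj -subn_eq0 E.
have [ln|ln] := ltnP (size l1) n.
  rewrite (bigD1 (Ordinal ln))//= big1 ?addr0 => [|j jl]; first by case: (_ != _); rewrite ?lexx ?ler01.
  by rewrite same ?eqxx.
rewrite big1 ?ler01// => j _; rewrite same ?eqxx// neq_ltn.
by rewrite (leq_trans (ltn_ord j) ln).
Qed.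

End TorusBounds.

Lemma exists_nat_powR (R : realType) (a M : R) : 0 < a ->
  exists2 n : nat, (0 < n)%N & M <= n%:R `^ a.
Proof.
move=> a0; exists (Num.truncn (`|M| `^ a^-1)).+1 => //.
apply: le_trans (ler_norm M) _; set N := _.+1.
rewrite (_ : `|M| = (`|M| `^ a^-1) `^ a); last by rewrite -powRrM mulVf ?gt_eqF// powRr1.
apply: ge0_ler_powR; rewrite ?nnegrE ?powR_ge0 ?(ltW a0)//.
by apply: ltW; exact: truncnS_gt.
Qed.

(** The choice of the parameters: d = B / m^q makes the left side B^s; for m and n
large the right side is at most 3 C, and B is such that B^s = 3 C + 1. *)
Lemma scaling_contradiction (R : realType) (p q s C : R) :
  0 < p -> 2 < q -> 1 < s -> 0 < C ->
  (forall d n m, 0 < d -> d <= 1 -> (0 < n)%N -> (0 < m)%N ->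
    (d * m%:R `^ q) `^ s <=
    C * (1 + m%:R `^ p * (d * n%:R `^ (1 - s) + d `^ (p / 2)))) -> False.
Proof.
move=> p0 q2 s1 C0 H; pose B := (3 * C + 1) `^ s^-1.
have C1 : 0 < 3 * C + 1 by lra.
have B0 : 0 < B by rewrite powR_gt0.
(* m^(q-2) >= B gives both d <= 1 and m^2 d <= 1 *)
have [m m0 hm] := @exists_nat_powR R (q - 2) B ltac:(lra).
have mp : 0 < m%:R :> R by rewrite ltr0n.
have m1 : 1 <= m%:R :> R by rewrite ler1n.
have mq : 0 < (m%:R : R) `^ q by rewrite powR_gt0.
pose d := B / m%:R `^ q.
have d0 : 0 < d by rewrite divr_gt0.
have d1 : d <= 1.
  rewrite ler_pdivrMr// mul1r; apply: le_trans hm _.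
  by apply: ler_powR => //; lra.
(* n makes the edge term at most d^(p/2), the last term of the bound *)
have [n n0 hn] := @exists_nat_powR R (s - 1) (d `^ (1 - p / 2)) ltac:(lra).
have np : 0 < n%:R :> R by rewrite ltr0n.
have := H d n m d0 d1 n0 m0.
rewrite {1}/d divfK ?gt_eqF// /B -powRrM mulVf ?gt_eqF//; last by lra.
rewrite powRr1 ?(ltW C1)//.
have e1 : d * n%:R `^ (1 - s) <= d `^ (p / 2).
  rewrite (_ : 1 - s = - (s - 1)); last by ring.
  rewrite powRN ler_pdivrMr ?powR_gt0//.
  apply: le_trans (ler_wpM2l (powR_ge0 _ _) hn).
  rewrite -powRD; last by rewrite (gt_eqF d0) implybT.
  by rewrite addrC subrK powRr1// ltW.
have e2 : m%:R `^ p * d `^ (p / 2) <= 1.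
  have -> : (m%:R : R) `^ p = (m%:R `^ 2) `^ (p / 2).
    by rewrite -powRrM; congr (_ `^ _); field.
  rewrite -powRM ?powR_ge0 ?(ltW d0)//.
  apply: (@le_trans _ _ (1 `^ (p / 2))); last by rewrite powR1.
  apply: ge0_ler_powR; rewrite ?nnegrE ?mulr_ge0 ?powR_ge0 ?(ltW d0)//; first by lra.
  rewrite /d mulrA ler_pdivrMr// mul1r.
  apply: le_trans (ler_wpM2l (powR_ge0 _ _) hm) _.
  rewrite -powRD; last by rewrite (gt_eqF mp) implybT.
  by rewrite addrC subrK.
have e3 := ler_wpM2l (powR_ge0 (m%:R : R) p) e1.
have : C * (1 + m%:R `^ p * (d * n%:R `^ (1 - s) + d `^ (p / 2))) <= C * 3.
  by apply: ler_wpM2l; [exact: ltW|lra].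
lra.
Qed.

Theorem theorem4p6 (R : realType) (p q : R) (hq : 2 < q) (hqp : q < p)
    (theta L : R) (htheta0 : 0 < theta) (htheta1 : theta <= 1) (hL : 1 <= L)
    (f : Lpsphere (EFin_ge1 hq) -> Lp01 (EFin_ge1 (lt_trans hq hqp)))
    (hf : forall x y : Lpsphere (EFin_ge1 hq),
      (Lpdist (val x) (val y) `^ theta <= Lpdist (f x) (f y)
         <= L%:E * Lpdist (val x) (val y) `^ theta)%E) :
  theta <= q / p.
Proof.
rewrite leNgt; apply/negP => hth.
have p2 : 2 < p by exact: lt_trans hq hqp.
have p0 : 0 < p by lra.
have q0 : 0 < q by lra.
pose s := theta * p / q.
have s1 : 1 < s by rewrite /s ltr_pdivlMr// mul1r -ltr_pdivrMr.
have [C C0 hC] := metric_Xp_Lp p (EFin_ge1 (lt_trans hq hqp)) p2.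
have Lp0 : 0 < L `^ p by rewrite powR_gt0//; lra.
apply: (@scaling_contradiction R p q s (C * L `^ p * (4 `^ q) `^ s)) => //.
  by rewrite !mulr_gt0// !powR_gt0.
move=> d n m d0 d1 n0; case: m => // k _.
have [U [D [U1 UD Djump Dsmall]]] := @sphere_torus k R n q (EFin_ge1 hq) n0.
pose F x := f (SigSub (mem_set (U1 x))).
pose K x y := Lpgap p _ (F x) (F y).
have KD x y : D x y `^ s <= K x y /\ K x y <= L `^ p * D x y `^ s.
  have [Ue D0] := UD x y.
  have := hf (SigSub (mem_set (U1 x))) (SigSub (mem_set (U1 y))).
  rewrite /= Ue poweR_EFin -powRrM -EFinM => /andP[lo hi].
  have fn : Lpdist (F x) (F y) \is a fin_num.
    by rewrite ge0_fin_numE; [exact: le_lt_trans hi (ltry _)|exact: Lnorm_ge0].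
  rewrite -(fineK fn) !lee_fin in lo hi.
  have E : (D x y `^ (q^-1 * theta)) `^ p = D x y `^ s.
    by rewrite -powRrM; congr (_ `^ _); rewrite /s; ring.
  have fge : 0 <= fine (Lpdist (F x) (F y)) by apply: le_trans lo; exact: powR_ge0.
  split; rewrite /K /Lpgap -E.
    by apply: ge0_ler_powR; rewrite ?nnegrE ?powR_ge0 ?(ltW p0).
  rewrite -powRM ?powR_ge0//; last by lra.
  by apply: ge0_ler_powR; rewrite ?nnegrE ?mulr_ge0 ?powR_ge0 ?(ltW p0)//; lra.
pose M : R := k.+1%:R; have M0 : 0 < M by rewrite ltr0n.
pose r := (8 / M) `^ q; have r0 : 0 < r by rewrite powR_gt0// divr_gt0.
have Kle (t : R) (x y : 'rV['I_(4 * k + 3).+1]_n) : 0 <= t -> (forall j, small k R (y 0 j - x 0 j)) ->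
    \sum_(j < n) (x 0 j != y 0 j)%:R / n%:R <= t -> K x y <= L `^ p * (r * t) `^ s.
  move=> t0 sm ht; apply: le_trans (KD x y).2 _; rewrite ler_pM2l//.
  have Drt : D x y <= r * t by apply: le_trans (Dsmall _ _ sm) _; rewrite ler_pM2l.
  apply: ge0_ler_powR => //; rewrite ?nnegrE; first lra.
    exact: (UD x y).2.
  exact: (mulr_ge0 (ltW r0) t0).
pose A := L `^ p * r `^ s.
have np : 0 < n%:R :> R by rewrite ltr0n.
have An : n%:R * (L `^ p * (r * n%:R^-1) `^ s) = A * n%:R `^ (1 - s).
  rewrite powRM ?invr_ge0 ?(ltW r0)// -powR_inv1// -powRrM mulN1r.
  rewrite powRD; last by rewrite (gt_eqF np) implybT.
  by rewrite powRr1// /A; ring.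
have J : #|'rV['I_(4 * k + 3).+1]_n|%:R * (2 `^ q * d) `^ s <= jumps d n (unit_row k n) k.+1 K.
  apply: jumps_ge; rewrite ?(ltW d0) ?(ltW s1) ?powR_ge0// => x S e.
  by rewrite -(Djump x S e); exact: (KD _ _).1.
have S : smears d n (unit_row k n) K <= #|'rV['I_(4 * k + 3).+1]_n|%:R * A.
  apply: smears_le; rewrite ?(ltW d0)// => x S e; rewrite /A -[r]mulr1.
  by apply: Kle => // [j|]; [exact: small_walk|exact: changed_le1].
have E : edges n (unit_row k n) K <= #|'rV['I_(4 * k + 3).+1]_n|%:R * (A * n%:R `^ (1 - s)).
  rewrite -An; apply: edges_le => x l1 l2.
  by apply: Kle => // [j|]; [exact: small_vertex|exact: changed_edge].
have Dg : diagonals n (unit_row k n) K <= #|'rV['I_(4 * k + 3).+1]_n|%:R * A.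
  apply: diagonals_le => x e e'; rewrite /A -[r]mulr1.
  by apply: Kle => // [j|]; [exact: small_vertex|exact: changed_le1].
have := hC _ d n (unit_row k n) k.+1 F (ltW d0) d1 isT.
rewrite -/K -/M.
set N : R := #|_|%:R in J S E Dg *.
have N0 : 0 < N by rewrite ltr0n; apply/card_gt0P; exists 0.
move=> /(le_trans J) H.
have Mp : 0 <= M `^ p by exact: powR_ge0.
have dp : 0 <= d `^ (p / 2) by exact: powR_ge0.
have k1 := ler_wpM2l (ltW d0) E.
have k2 := ler_wpM2l dp Dg.
have k3 := ler_wpM2l Mp (lerD k1 k2).
have k4 := ler_wpM2l (ltW C0) (lerD S k3).
have {H}H := le_trans H k4.
set T := 1 + _.
have {}H : (2 `^ q * d) `^ s <= C * A * T.
  rewrite -(ler_pM2l N0); apply: le_trans H _.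
  by rewrite le_eqVlt; apply/orP; left; apply/eqP; rewrite /T -/M; ring.
have Ms : 0 <= ((M / 2) `^ q) `^ s by exact: powR_ge0.
have := ler_wpM2r Ms H.
rewrite -powRM ?mulr_ge0 ?powR_ge0 ?(ltW d0)//.
have -> : 2 `^ q * d * (M / 2) `^ q = d * M `^ q.
  rewrite mulrAC -powRM ?divr_ge0 ?(ltW M0)// mulrC; congr (_ * _ `^ _).
  by field.
move/le_trans; apply; rewrite le_eqVlt; apply/orP; left; apply/eqP.
have -> : (4 `^ q) `^ s = r `^ s * ((M / 2) `^ q) `^ s.
  have M8 : 0 <= 8 / M by rewrite divr_ge0// ltW.
  have M2 : 0 <= M / 2 by rewrite divr_ge0// ltW.
  rewrite -(powRM _ (ltW r0) (powR_ge0 _ _)) /r -(powRM _ M8 M2).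
  have -> // : 8 / M * (M / 2) = 4; field; exact: lt0r_neq0.
rewrite /A; ring.
Qed.
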